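(* Fix $\lambda>0$. Let $K\subset\mathrm{SO}(5)$ be a connected closed subgroup and suppose some $K$-orbit $L=K\cdot p\subset\Lambda^2_-S^4$ is a 4-dimensional coassociative submanifold of $(\Lambda^2_-S^4,\varphi_\lambda)$. Then $L$ is the zero section $S^4\subset\Lambda^2_-S^4$. Equivalently, every homogeneous coassociative submanifold of $(\Lambda^2_-S^4,\varphi_\lambda)$ is congruent under $\mathrm{SO}(5)$ to the zero section.
   Context: Let $S^4=\{x={}^t(x_1,\dots,x_5)\in\mathbb R^5:|x|=1\}$ with the round metric and let $\pi:\Lambda^2_-S^4\to S^4$ be the rank-3 bundle of anti-self-dual 2-forms. On $S^4\setminus\{x_5=\pm1\}$ use the oriented orthonormal frame $e_1=\frac{1}{\sqrt{1-x_5^2}}{}^t(-x_2,x_1,-x_4,x_3,0)$, $e_2=\frac{1}{\sqrt{1-x_5^2}}{}^t(-x_3,x_4,x_1,-x_2,0)$, $e_3=\frac{1}{\sqrt{1-x_5^2}}{}^t(-x_4,-x_3,x_2,x_1,0)$, $e_4=\frac{1}{\sqrt{1-x_5^2}}{}^t(-x_1x_5,-x_2x_5,-x_3x_5,-x_4x_5,1-x_5^2)$ with dual coframe $e^1,\dots,e^4$, and set $\omega_1=e^{12}-e^{34}$, $\omega_2=e^{13}-e^{42}$, $\omega_3=e^{14}-e^{23}$ ($e^{ij}=e^i\wedge e^j$), a local frame of $\Lambda^2_-S^4$. The point $\sum_i a_i\omega_i|_x$ is written $(x,{}^t(a_1,a_2,a_3))$; $r^2=a_1^2+a_2^2+a_3^2$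 is the squared fiber norm (globally defined). Write $\nabla\omega_i=\sum_j\gamma_{ij}\otimes\omega_j$ for the connection induced by the Levi-Civita connection and $b_i=da_i+\sum_j a_j\pi^*\gamma_{ji}$. For $\lambda>0$ the Bryant–Salamon 3-form is $\varphi_\lambda=2s_\lambda\sum_{i=1}^3 b_i\wedge\pi^*\omega_i+s_\lambda^{-3}b_1\wedge b_2\wedge b_3$ with $s_\lambda=(\lambda+r^2)^{1/4}$ (equivalently $2s_\lambda d\tau+s_\lambda^{-3}\mathrm{vol}_{\mathcal V}$, $\tau$ the tautological 2-form, $\mathrm{vol}_{\mathcal V}$ the vertical volume form; it is globally defined). It is a torsion-free $G_2$-structure with a complete metric of holonomy $G_2$. A 4-dimensional submanifold $L$ is coassociative iff $\varphi_\lambda|_{TL}=0$. $\mathrm{SO}(5)$ acts on $S^4$ linearly and on $\Lambda^2_-S^4$ by the induced action on 2-forms ($g\cdot\omega=(g^{-1})^*\omega$); this action preserves $\varphi_\lambda$, and $\mathrm{SO}(5)$ is the automorphism group of $(\Lambda^2_-S^4,\varphi_\lambda)$. The zero section is identified with $S^4$. A homogeneous coassociative submanifold is one that is an orbit of a closed subgroup of the automorphism group. *)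

(* Defs.v *)
From Stdlib Require Fin.
From Stdlib Require Import Reals List Bool Arith.
Import ListNotations.
Open Scope R_scope.

Definition I5 := Fin.t 5.
Definition f0 : I5 := Fin.F1.
Definition f1 : I5 := Fin.FS Fin.F1.
Definition f2 : I5 := Fin.FS (Fin.FS Fin.F1).
Definition f3 : I5 := Fin.FS (Fin.FS (Fin.FS Fin.F1)).
Definition f4 : I5 := Fin.FS (Fin.FS (Fin.FS (Fin.FS Fin.F1))).

Definition sum5 (f : I5 -> R) : R := f f0 + f f1 + f f2 + f f3 + f f4.

Definition vec := I5 -> R.
Definition mat := I5 -> I5 -> R.

Definition dot (u v : vec) : R := sum5 (fun i => u i * v i).
Definition mv (A : mat) (v : vec) : vec := fun i => sum5 (fun j => A i j * v j).
Definition mm (A B : mat) : mat := fun i j => sum5 (fun k => A i k * B k j).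
Definition tr (A : mat) : mat := fun i j => A j i.
Definition id5 : mat := fun i j => if Fin.eqb i j then 1 else 0.
Definition zmat : mat := fun _ _ => 0.
Definition mtrace (A : mat) : R := sum5 (fun i => A i i).
Definition bil (A : mat) (u w : vec) : R := dot u (mv A w).

Definition idx (i : I5) : nat := proj1_sig (Fin.to_nat i).
Fixpoint inversions (l : list nat) : nat :=
  match l with
  | nil => 0%nat
  | a :: t => (length (filter (fun b => Nat.ltb b a) t) + inversions t)%nat
  end.
Fixpoint nodupb (l : list nat) : bool :=
  match l with
  | nil => true
  | a :: t => negb (existsb (Nat.eqb a) t) && nodupb t
  end.
Definition eps (l : list nat) : R :=
  if nodupb l then (-1) ^ (inversions l) else 0.
Definition eps5 (i j k l m : I5) : R := eps (map idx [i; j; k; l; m]).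

Definition det5 (A : mat) : R :=
  sum5 (fun i => sum5 (fun j => sum5 (fun k => sum5 (fun l => sum5 (fun m =>
    eps5 i j k l m * A f0 i * A f1 j * A f2 k * A f3 l * A f4 m))))).

Definition SO5 (g : mat) : Prop := mm (tr g) g = id5 /\ det5 g = 1.

(* A 2-form on T_x S^4 = x^perp is a skew matrix A with A x = 0,
   alpha(u,w) = u^T A w.  S^4 is oriented by vol(v1..v4) = det(x,v1,..,v4)
   (this is the orientation of the paper's frame e1..e4).  Hodge star on x^perp: *)
Definition hodge (x : vec) (A : mat) : mat := fun i j =>
  / 2 * sum5 (fun k => sum5 (fun l => sum5 (fun m => eps5 m i j k l * x m * A k l))).

Definition pt := (vec * mat)%type.

Definition inE (q : pt) : Prop :=
  let (x, A) := q in
  dot x x = 1 /\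
  (forall i j, A i j = - A j i) /\
  (forall i, mv A x i = 0) /\
  (forall i j, hodge x A i j = - A i j).

Definition zero_section (q : pt) : Prop := dot (fst q) (fst q) = 1 /\ snd q = zmat.

(* SO(5) action: g . (x, alpha) = (g x, (g^{-1})^* alpha) *)
Definition act (g : mat) (q : pt) : pt := (mv g (fst q), mm (mm g (snd q)) (tr g)).

(* squared fiber norm r^2 = a1^2+a2^2+a3^2 (|omega_i| = 1, i.e. 1/4 Frobenius) *)
Definition r2 (A : mat) : R := / 4 * sum5 (fun i => sum5 (fun j => A i j ^ 2)).
Definition s_lam (lam : R) (A : mat) : R := Rpower (lam + r2 A) (/ 4).

(* tangent vectors to the total space: (v, B) = d/dt (x(t), A(t)) *)
Definition tv := (vec * mat)%type.
Definition tzero : tv := (fun _ => 0, zmat).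
Definition tadd (a b : tv) : tv :=
  (fun i => fst a i + fst b i, fun i j => snd a i j + snd b i j).
Definition tscale (c : R) (a : tv) : tv :=
  (fun i => c * fst a i, fun i j => c * snd a i j).

(* projection onto Lambda^2(x^perp): Levi-Civita covariant derivative of A along xi,
   i.e. the 2-form  sum_i b_i(xi) omega_i *)
Definition projx (x : vec) : mat := fun i j => id5 i j - x i * x j.
Definition vert (x : vec) (B : mat) : mat := mm (mm (projx x) B) (projx x).

(* phi_lambda at q evaluated on tangent vectors xi1 xi2 xi3:
   2 s sum_i (b_i /\ pi^* omega_i) + s^{-3} b_1/\b_2/\b_3, with
   sum_i b_i(xi) omega_i(v,w) = v^T W w  (W = vertical part of xi) and
   b1/\b2/\b3(xi1,xi2,xi3) = det[b_i(xi_j)] = - tr(W1 W2 W3) / 4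
   (the normalising constant tr(omega1 omega2 omega3) = -4). Wedge products use the
   determinant convention (b /\ w)(X,Y,Z) = b(X) w(Y,Z) - b(Y) w(X,Z) + b(Z) w(X,Y). *)
Definition phi (lam : R) (q : pt) (xi1 xi2 xi3 : tv) : R :=
  let x := fst q in
  let A := snd q in
  let s := s_lam lam A in
  let v1 := fst xi1 in let v2 := fst xi2 in let v3 := fst xi3 in
  let W1 := vert x (snd xi1) in let W2 := vert x (snd xi2) in let W3 := vert x (snd xi3) in
  2 * s * (bil W1 v2 v3 + bil W2 v3 v1 + bil W3 v1 v2)
  + (- mtrace (mm (mm W1 W2) W3) / 4) / s ^ 3.

Definition mdist2 (A B : mat) : R := sum5 (fun i => sum5 (fun j => (A i j - B i j) ^ 2)).
Definition open_m (U : mat -> Prop) : Prop :=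
  forall A, U A -> exists e, 0 < e /\ forall B, mdist2 A B < e -> U B.
Definition closed_m (S : mat -> Prop) : Prop :=
  forall A, (forall e, 0 < e -> exists B, S B /\ mdist2 A B < e) -> S A.
Definition connected_m (S : mat -> Prop) : Prop :=
  forall U V, open_m U -> open_m V ->
    (forall A, S A -> U A \/ V A) ->
    (forall A, ~ (S A /\ U A /\ V A)) ->
    (forall A, S A -> U A) \/ (forall A, S A -> V A).
Definition subgroup (K : mat -> Prop) : Prop :=
  K id5 /\ (forall g h, K g -> K h -> K (mm g h)) /\
  (forall g, K g -> exists h, K h /\ mm g h = id5 /\ mm h g = id5).

Definition lie (K : mat -> Prop) (X : mat) : Prop :=
  exists c : R -> mat, (forall t, K (c t)) /\ c 0 = id5 /\
    forall i j, derivable_pt_lim (fun t => c t i j) 0 (X i j).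

Definition orbit (K : mat -> Prop) (p q : pt) : Prop := exists g, K g /\ q = act g p.

(* fundamental vector field of X at q: d/dt|0 exp(tX).q *)
Definition fvec (X : mat) (q : pt) : tv :=
  (mv X (fst q), fun i j => mm X (snd q) i j + mm (snd q) (tr X) i j).

(* the tangent space {fvec X q : X in Lie K} of the orbit at q is 4-dimensional *)
Definition tdim4 (K : mat -> Prop) (q : pt) : Prop :=
  exists X1 X2 X3 X4, lie K X1 /\ lie K X2 /\ lie K X3 /\ lie K X4 /\
    (forall c1 c2 c3 c4,
       tadd (tadd (tscale c1 (fvec X1 q)) (tscale c2 (fvec X2 q)))
            (tadd (tscale c3 (fvec X3 q)) (tscale c4 (fvec X4 q))) = tzero ->
       c1 = 0 /\ c2 = 0 /\ c3 = 0 /\ c4 = 0) /\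
    (forall X, lie K X -> exists c1 c2 c3 c4,
       fvec X q = tadd (tadd (tscale c1 (fvec X1 q)) (tscale c2 (fvec X2 q)))
                       (tadd (tscale c3 (fvec X3 q)) (tscale c4 (fvec X4 q)))).

Definition coassoc_orbit (lam : R) (K : mat -> Prop) (p : pt) : Prop :=
  forall q, orbit K p q ->
    tdim4 K q /\
    (forall X Y Z, lie K X -> lie K Y -> lie K Z ->
       phi lam q (fvec X q) (fvec Y q) (fvec Z q) = 0).

(* Main.v *)
Require Import Defs.
From Stdlib Require Import Reals.
From Stdlib Require Import Lra Lia List Classical ClassicalEpsilon FunctionalExtensionality.
From Stdlib Require Fin.
Import ListNotations.
Open Scope R_scope.

(** Let p = (x, A).  The vertical part of a fundamental field at p is the bracket of A with
    the anti-self-dual part of the isotropy component, hence orthogonal to A; so for A <> 0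
    the tangent space of the orbit lies in C^3 = T_x S^4 + A^perp, where phi_lambda reduces
    to a multiple of Re Omega for a complex volume form Omega.  A real 4-dimensional
    subspace on which Re Omega vanishes is complex, so Im Omega vanishes on it too.  Read on
    the Lie algebra of K, closedness of Im Omega along the orbit says that an alternating
    sum of values Im Omega([X, Y], Z, T) is zero; but d Im Omega is definite on complex
    planes, as in any nearly Kaehler manifold (here the twistor space CP^3).  Hence A = 0.

    On the zero section, an orbit all of whose tangent spaces are 4-dimensional is all of
    S^4: a point y of the compact orbit maximising <y, z> satisfies y = z or y = -z, and the
    second case would force the orbit to be a point. *)

(** * Algebra of vectors and matrices indexed by [I5] *)

Lemma I5_ind (P : I5 -> Prop) :
  P f0 -> P f1 -> P f2 -> P f3 -> P f4 -> forall i, P i.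
Proof.
  intros H0 H1 H2 H3 H4 i.
  apply (Fin.caseS' i); [exact H0 | clear i; intro i].
  apply (Fin.caseS' i); [exact H1 | clear i; intro i].
  apply (Fin.caseS' i); [exact H2 | clear i; intro i].
  apply (Fin.caseS' i); [exact H3 | clear i; intro i].
  apply (Fin.caseS' i); [exact H4 | clear i; intro i].
  exact (Fin.case0 (fun _ => _) i).
Qed.

Ltac cases5 i := pattern i; apply I5_ind; clear i.

Lemma mat_ext (A B : mat) : (forall i j, A i j = B i j) -> A = B.
Proof.
  intro H; apply functional_extensionality; intro i.
  apply functional_extensionality; intro j; apply H.
Qed.

Lemma vec_ext (u v : vec) : (forall i, u i = v i) -> u = v.
Proof. intro H; apply functional_extensionality; exact H. Qed.

Lemma mm_assoc (A B C : mat) : mm A (mm B C) = mm (mm A B) C.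
Proof. apply mat_ext; intros i j; unfold mm, sum5; ring. Qed.

Lemma mm_id_l (A : mat) : mm id5 A = A.
Proof.
  apply mat_ext; intros i j; cases5 i; unfold mm, sum5, id5; simpl; ring.
Qed.

Lemma mm_id_r (A : mat) : mm A id5 = A.
Proof.
  apply mat_ext; intros i j; cases5 j; unfold mm, sum5, id5; simpl; ring.
Qed.

Lemma mv_id (v : vec) : mv id5 v = v.
Proof. apply vec_ext; intros i; cases5 i; unfold mv, sum5, id5; simpl; ring. Qed.

Lemma mv_mm (A B : mat) (v : vec) : mv (mm A B) v = mv A (mv B v).
Proof. apply vec_ext; intro i; unfold mv, mm, sum5; ring. Qed.

Lemma tr_mm (A B : mat) : tr (mm A B) = mm (tr B) (tr A).
Proof. apply mat_ext; intros i j; unfold tr, mm, sum5; ring. Qed.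

Lemma tr_id : tr id5 = id5.
Proof. apply mat_ext; intros i j; cases5 i; cases5 j; reflexivity. Qed.

Lemma mtrace_mm_comm (A B : mat) : mtrace (mm A B) = mtrace (mm B A).
Proof. unfold mtrace, mm, sum5; ring. Qed.

Lemma dot_mv_tr (A : mat) (u v : vec) : dot (mv A u) v = dot u (mv (tr A) v).
Proof. unfold dot, mv, tr, sum5; ring. Qed.

Lemma dot_sym (u v : vec) : dot u v = dot v u.
Proof. unfold dot, sum5; ring. Qed.

Lemma sum5_sqr_eq0 (f : I5 -> R) : sum5 (fun i => f i ^ 2) = 0 -> forall i, f i = 0.
Proof.
  unfold sum5; intros H i.
  pose proof (pow2_ge_0 (f f0)); pose proof (pow2_ge_0 (f f1));
  pose proof (pow2_ge_0 (f f2)); pose proof (pow2_ge_0 (f f3));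
  pose proof (pow2_ge_0 (f f4)).
  cases5 i; apply Rsqr_0_uniq; unfold Rsqr; lra.
Qed.

Lemma sum5_ge0 (f : I5 -> R) : (forall i, 0 <= f i) -> 0 <= sum5 f.
Proof.
  intro H; unfold sum5.
  pose proof (H f0); pose proof (H f1); pose proof (H f2); pose proof (H f3);
  pose proof (H f4); lra.
Qed.

Lemma sum5_eq0 (f : I5 -> R) : (forall i, 0 <= f i) -> sum5 f = 0 -> forall i, f i = 0.
Proof.
  unfold sum5; intros H H' i.
  pose proof (H f0); pose proof (H f1); pose proof (H f2); pose proof (H f3);
  pose proof (H f4); cases5 i; lra.
Qed.

Lemma frob_eq0 (A : mat) :
  sum5 (fun i => sum5 (fun j => A i j ^ 2)) = 0 -> A = zmat.
Proof.
  intro H; apply mat_ext; intros i j; unfold zmat.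
  apply (sum5_sqr_eq0 (A i)).
  apply (sum5_eq0 (fun i => sum5 (fun j => A i j ^ 2))); [|exact H].
  intro k; apply sum5_ge0; intro; apply pow2_ge_0.
Qed.

Lemma dot_eq0 (v : vec) : dot v v = 0 -> forall i, v i = 0.
Proof.
  intro H; apply sum5_sqr_eq0; rewrite <- H; unfold dot, sum5; ring.
Qed.

Lemma dot_ge0 (v : vec) : 0 <= dot v v.
Proof. apply sum5_ge0; intro i; apply Rle_0_sqr. Qed.

(* E = 1 - G^T G is a symmetric idempotent of trace 0, so its Frobenius norm vanishes. *)
Lemma orthogonal_comm (G : mat) : mm G (tr G) = id5 -> mm (tr G) G = id5.
Proof.
  intro H.
  set (E := fun i j => id5 i j - mm (tr G) G i j).
  assert (HP : mm (mm (tr G) G) (mm (tr G) G) = mm (tr G) G).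
  { rewrite mm_assoc, <- (mm_assoc (tr G) G), H, mm_id_r; reflexivity. }
  assert (HT : tr (mm (tr G) G) = mm (tr G) G) by (rewrite tr_mm; reflexivity).
  assert (Htr : mtrace (mm (tr G) G) = mtrace id5)
    by (rewrite mtrace_mm_comm, H; reflexivity).
  set (P := mm (tr G) G) in *.
  assert (HE : E = zmat).
  { apply frob_eq0.
    transitivity (mtrace id5 - 2 * mtrace P + mtrace (mm (tr P) P)).
    - unfold E, mtrace, mm, sum5, id5, tr; simpl; ring.
    - rewrite HT, HP, Htr; ring. }
  apply mat_ext; intros i j.
  pose proof (f_equal (fun M : mat => M i j) HE) as He; unfold E, zmat in He; lra.
Qed.

(** * Equivariance *)

Definition conjm (G M : mat) : mat := mm (mm G M) (tr G).

Lemma conj_mm (G A B : mat) :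
  mm (tr G) G = id5 -> conjm G (mm A B) = mm (conjm G A) (conjm G B).
Proof.
  intro H; unfold conjm.
  rewrite (mm_assoc (mm (mm G A) (tr G))), (mm_assoc _ G B).
  rewrite <- (mm_assoc (mm G A) (tr G) G), H, mm_id_r, !mm_assoc; reflexivity.
Qed.

Lemma conj_tr (G A : mat) : conjm G (tr A) = tr (conjm G A).
Proof. unfold conjm; rewrite !tr_mm, mm_assoc; reflexivity. Qed.

Lemma conj_id (G : mat) : mm G (tr G) = id5 -> conjm G id5 = id5.
Proof. intro H; unfold conjm; rewrite mm_id_r; exact H. Qed.

Lemma conj_conj (G H A : mat) : conjm G (conjm H A) = conjm (mm G H) A.
Proof. unfold conjm; rewrite tr_mm, !mm_assoc; reflexivity. Qed.

Lemma conj_id_l (A : mat) : conjm id5 A = A.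
Proof. unfold conjm; rewrite tr_id, mm_id_l, mm_id_r; reflexivity. Qed.

Lemma conj_trK (G A : mat) : mm G (tr G) = id5 -> conjm G (conjm (tr G) A) = A.
Proof. intro H; rewrite conj_conj, H; apply conj_id_l. Qed.

Lemma conj_add (G A B : mat) :
  conjm G (fun i j => A i j + B i j) = (fun i j => conjm G A i j + conjm G B i j).
Proof. apply mat_ext; intros i j; unfold conjm, mm, sum5; ring. Qed.

Lemma conj_scale (G A : mat) (a : R) :
  conjm G (fun i j => a * A i j) = (fun i j => a * conjm G A i j).
Proof. apply mat_ext; intros i j; unfold conjm, mm, sum5; ring. Qed.

Lemma mv_conj (G A : mat) (v : vec) :
  mm (tr G) G = id5 -> mv (conjm G A) (mv G v) = mv G (mv A v).
Proof.
  intro H; rewrite <- mv_mm; unfold conjm.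
  rewrite <- mm_assoc, H, mm_id_r, mv_mm; reflexivity.
Qed.

Lemma dot_mv (G : mat) (u v : vec) :
  mm (tr G) G = id5 -> dot (mv G u) (mv G v) = dot u v.
Proof. intro H; rewrite dot_mv_tr, <- mv_mm, H, mv_id; reflexivity. Qed.

Lemma bil_conj (G A : mat) (u v : vec) :
  mm (tr G) G = id5 -> bil (conjm G A) (mv G u) (mv G v) = bil A u v.
Proof. intro H; unfold bil; rewrite mv_conj, dot_mv by exact H; reflexivity. Qed.

Lemma mtrace_conj (G A : mat) : mm (tr G) G = id5 -> mtrace (conjm G A) = mtrace A.
Proof.
  intro H; unfold conjm; rewrite mtrace_mm_comm, mm_assoc, H, mm_id_l; reflexivity.
Qed.

Lemma r2_mtrace (A : mat) : r2 A = / 4 * mtrace (mm A (tr A)).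
Proof. unfold r2, mtrace, mm, tr, sum5; ring. Qed.

Lemma projx_conj (G : mat) (x : vec) :
  mm G (tr G) = id5 -> projx (mv G x) = conjm G (projx x).
Proof.
  intro H; apply mat_ext; intros i j.
  transitivity (conjm G id5 i j - mv G x i * mv G x j).
  - rewrite conj_id by exact H; reflexivity.
  - unfold conjm, projx, mv, mm, tr, sum5; ring.
Qed.

Definition tact (G : mat) (xi : tv) : tv := (mv G (fst xi), conjm G (snd xi)).

(** The projector, bilinear forms and traces in [phi] are all compatible with orthogonal
    conjugation. No orientation enters, so no determinant has to be computed for the frames chosen
    below. *)
Lemma phi_act (G : mat) (lam : R) (q : pt) (xi1 xi2 xi3 : tv) :
  mm (tr G) G = id5 -> mm G (tr G) = id5 ->
  phi lam (act G q) (tact G xi1) (tact G xi2) (tact G xi3) = phi lam q xi1 xi2 xi3.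
Proof.
  intros H H'; destruct q as [x A]; unfold phi, act, tact; simpl.
  change (mm (mm G A) (tr G)) with (conjm G A).
  unfold s_lam, vert; rewrite !r2_mtrace, <- conj_tr, <- conj_mm, mtrace_conj by exact H.
  rewrite !projx_conj by exact H'.
  rewrite <- !conj_mm, mtrace_conj, !bil_conj by exact H.
  reflexivity.
Qed.

Lemma fvec_act (G X : mat) (q : pt) :
  mm (tr G) G = id5 -> fvec (conjm G X) (act G q) = tact G (fvec X q).
Proof.
  intros H; destruct q as [x A]; unfold fvec, act, tact; simpl.
  change (mm (mm G A) (tr G)) with (conjm G A).
  rewrite mv_conj by exact H; f_equal.
  rewrite <- conj_tr, <- !conj_mm, conj_add by exact H; reflexivity.
Qed.

(** * The Lie algebra of a group of orthogonal matrices *)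

Definition mderiv (c : R -> mat) (t : R) (X : mat) : Prop :=
  forall i j, derivable_pt_lim (fun s => c s i j) t (X i j).

Lemma derivable_pt_lim_sum5 (f : I5 -> R -> R) (t : R) (l : I5 -> R) :
  (forall i, derivable_pt_lim (f i) t (l i)) ->
  derivable_pt_lim (fun s => sum5 (fun i => f i s)) t (sum5 l).
Proof.
  intro H; unfold sum5.
  apply (derivable_pt_lim_plus (fun s => f f0 s + f f1 s + f f2 s + f f3 s) (f f4)); auto.
  apply (derivable_pt_lim_plus (fun s => f f0 s + f f1 s + f f2 s) (f f3)); auto.
  apply (derivable_pt_lim_plus (fun s => f f0 s + f f1 s) (f f2)); auto.
  apply (derivable_pt_lim_plus (f f0) (f f1)); auto.
Qed.

Lemma sum5_add (f g : I5 -> R) : sum5 (fun i => f i + g i) = sum5 f + sum5 g.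
Proof. unfold sum5; ring. Qed.

Lemma mderiv_const (M : mat) (t : R) : mderiv (fun _ => M) t zmat.
Proof. intros i j; apply derivable_pt_lim_const. Qed.

Lemma mderiv_tr (c : R -> mat) (t : R) (X : mat) :
  mderiv c t X -> mderiv (fun s => tr (c s)) t (tr X).
Proof. intros H i j; exact (H j i). Qed.

Lemma mderiv_mm (c d : R -> mat) (t : R) (X Y : mat) :
  mderiv c t X -> mderiv d t Y ->
  mderiv (fun s => mm (c s) (d s)) t (fun i j => mm X (d t) i j + mm (c t) Y i j).
Proof.
  intros HX HY i j; unfold mm; rewrite <- sum5_add.
  apply (derivable_pt_lim_sum5 (fun k s => c s i k * d s k j)); intro k.
  apply (derivable_pt_lim_mult (fun s => c s i k) (fun s => d s k j)); auto.
Qed.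

Lemma mderiv_eq (c : R -> mat) (t : R) (X Y : mat) :
  mderiv c t X -> X = Y -> mderiv c t Y.
Proof. intros H <-; exact H. Qed.

Lemma mm_zmat_l (A : mat) : mm zmat A = zmat.
Proof. apply mat_ext; intros i j; unfold mm, zmat, sum5; ring. Qed.

Lemma mm_zmat_r (A : mat) : mm A zmat = zmat.
Proof. apply mat_ext; intros i j; unfold mm, zmat, sum5; ring. Qed.

Lemma mderiv_mm_const (A B : mat) (c : R -> mat) (t : R) (X : mat) :
  mderiv c t X -> mderiv (fun s => mm (mm A (c s)) B) t (mm (mm A X) B).
Proof.
  intro H.
  eapply mderiv_eq.
  { apply mderiv_mm; [apply mderiv_mm; [apply mderiv_const | exact H] | apply mderiv_const]. }
  rewrite mm_zmat_r; unfold zmat; apply mat_ext; intros i j; unfold mm, sum5; ring.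
Qed.

(** Differentiate [mm (tr (c t)) (c t) = id5] at 0. *)
Lemma lie_skew (K : mat -> Prop) (X : mat) :
  (forall g, K g -> mm (tr g) g = id5) -> lie K X -> forall i j, X i j = - X j i.
Proof.
  intros HK (c & Hc & H0 & HX) i j.
  pose proof (mderiv_mm _ _ _ _ _ (mderiv_tr _ _ _ HX) HX i j) as H1.
  cbv beta in H1; rewrite H0, tr_id, mm_id_r, mm_id_l in H1.
  assert (H2 : derivable_pt_lim (fun s => mm (tr (c s)) (c s) i j) 0 0).
  { replace (fun s => mm (tr (c s)) (c s) i j) with (fun _ : R => id5 i j).
    - apply derivable_pt_lim_const.
    - apply functional_extensionality; intro s; rewrite HK by auto; reflexivity. }
  pose proof (uniqueness_limite _ _ _ _ H1 H2) as H3; unfold tr in H3; lra.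
Qed.

(** The product of the two curves has velocity [X + Y] at 0. With the reparametrised curve of
    [lie_scale], [lie K] is closed under linear combinations. *)
Lemma lie_add (K : mat -> Prop) (X Y : mat) :
  subgroup K -> lie K X -> lie K Y -> lie K (fun i j => X i j + Y i j).
Proof.
  intros (_ & HM & _) (c & Hc & Hc0 & HX) (d & Hd & Hd0 & HY).
  exists (fun t => mm (c t) (d t)); split; [intro t; apply HM; auto | split].
  - rewrite Hc0, Hd0; apply mm_id_l.
  - apply (mderiv_eq _ _ _ _ (mderiv_mm _ _ _ _ _ HX HY)).
    rewrite Hc0, Hd0, mm_id_l, mm_id_r; reflexivity.
Qed.

Lemma lie_scale (K : mat -> Prop) (X : mat) (a : R) :
  lie K X -> lie K (fun i j => a * X i j).
Proof.
  intros (c & Hc & Hc0 & HX).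
  exists (fun t => c (a * t)); split; [intro t; apply Hc | split].
  - rewrite Rmult_0_r; exact Hc0.
  - intros i j; rewrite Rmult_comm.
    apply (derivable_pt_lim_comp (fun t => a * t) (fun s => c s i j)).
    + pose proof (derivable_pt_lim_scal id a 0 1 (derivable_pt_lim_id 0)) as H.
      rewrite Rmult_1_r in H; exact H.
    + rewrite Rmult_0_r; apply HX.
Qed.

Lemma subgroup_tr (K : mat -> Prop) (g : mat) :
  subgroup K -> (forall g, K g -> mm (tr g) g = id5) -> K g -> K (tr g).
Proof.
  intros (_ & _ & HI) HK Hg.
  destruct (HI g Hg) as (h & Hh & Hgh & _).
  replace (tr g) with h; [exact Hh|].
  rewrite <- (mm_id_l h), <- (HK g Hg), <- mm_assoc, Hgh, mm_id_r; reflexivity.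
Qed.

Lemma lie_conj (K : mat -> Prop) (g X : mat) :
  subgroup K -> (forall g, K g -> mm (tr g) g = id5) ->
  K g -> lie K X -> lie K (conjm g X).
Proof.
  intros HS HK Hg (c & Hc & Hc0 & HX).
  exists (fun t => conjm g (c t)); split; [| split].
  - intro t; apply (proj1 (proj2 HS)); [apply (proj1 (proj2 HS)); auto|]; apply subgroup_tr; auto.
  - rewrite Hc0; apply conj_id, (orthogonal_comm (tr g)), (HK g Hg).
  - apply mderiv_mm_const; exact HX.
Qed.

(** * Brackets and linear functionals that vanish on the Lie algebra *)

Definition pairing (C M : mat) : R := sum5 (fun i => sum5 (fun j => C i j * M i j)).

Definition bracket (X Y : mat) : mat := fun i j => mm X Y i j - mm Y X i j.

(* A functional vanishing on the Lie algebra vanishes along t |-> Ad (c t) Y; differentiate at 0. *)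
Lemma pairing_bracket (K : mat -> Prop) (C X Y : mat) :
  subgroup K -> (forall g, K g -> mm (tr g) g = id5) ->
  (forall Z, lie K Z -> pairing C Z = 0) ->
  lie K X -> lie K Y -> pairing C (bracket X Y) = 0.
Proof.
  intros HS HK HC HX HY.
  pose proof (lie_skew _ _ HK HX) as Hskew.
  destruct HX as (c & Hc & Hc0 & HX).
  assert (H1 : mderiv (fun t => conjm (c t) Y) 0 (bracket X Y)).
  { eapply mderiv_eq.
    { apply mderiv_mm; [apply mderiv_mm; [exact HX | apply mderiv_const]
                       | apply mderiv_tr; exact HX]. }
    cbv beta; rewrite Hc0, tr_id, !mm_id_l, !mm_id_r.
    unfold bracket, zmat; apply mat_ext; intros i j.
    unfold mm, sum5, tr.
    (* Skewness turns the transposed velocity into -X, so the derivative is XY - YX. *)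
    rewrite (Hskew j f0), (Hskew j f1), (Hskew j f2), (Hskew j f3), (Hskew j f4); ring. }
  assert (H2 : derivable_pt_lim (fun t => pairing C (conjm (c t) Y)) 0 (pairing C (bracket X Y))).
  { apply (derivable_pt_lim_sum5 (fun i t => sum5 (fun j => C i j * conjm (c t) Y i j))); intro i.
    apply (derivable_pt_lim_sum5 (fun j t => C i j * conjm (c t) Y i j)); intro j.
    apply (derivable_pt_lim_scal (fun t => conjm (c t) Y i j)); apply H1. }
  apply (uniqueness_limite _ _ _ _ H2).
  replace (fun t => pairing C (conjm (c t) Y)) with (fun _ : R => 0).
  - apply derivable_pt_lim_const.
  - apply functional_extensionality; intro t; symmetry; apply HC, lie_conj; auto.
Qed.

(** * Transport of the hypotheses to a conjugate group *)

(** For orthogonal [G], the group G K G^{-1}, written as a preimage so that membership unfolds to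
    membership in [K]. *)
Definition conj_group (G : mat) (K : mat -> Prop) : mat -> Prop :=
  fun g => K (conjm (tr G) g).

Lemma subgroup_conj_group (G : mat) (K : mat -> Prop) :
  mm (tr G) G = id5 -> mm G (tr G) = id5 -> subgroup K -> subgroup (conj_group G K).
Proof.
  intros H H' (H1 & HM & HI); split; [|split]; unfold conj_group.
  - rewrite conj_id; auto.
  - intros g h Hg Hh; rewrite conj_mm; auto.
  - intros g Hg; destruct (HI _ Hg) as (h & Hh & Hgh & Hhg).
    exists (conjm G h); rewrite (conj_trK (tr G)) by exact H; split; [exact Hh|].
    rewrite <- (conj_trK G g H'), <- !conj_mm, Hgh, Hhg, conj_id; auto.
Qed.

Lemma orthogonal_conj_group (G : mat) (K : mat -> Prop) :
  mm (tr G) G = id5 -> mm G (tr G) = id5 ->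
  (forall g, K g -> mm (tr g) g = id5) ->
  forall g, conj_group G K g -> mm (tr g) g = id5.
Proof.
  intros H H' HK g Hg; unfold conj_group in Hg.
  rewrite <- (conj_trK G g H'), <- conj_tr, <- conj_mm, HK, conj_id; auto.
Qed.

Lemma lie_conj_group (G : mat) (K : mat -> Prop) (X : mat) :
  mm (tr G) G = id5 -> mm G (tr G) = id5 ->
  lie K X -> lie (conj_group G K) (conjm G X).
Proof.
  intros H H' (c & Hc & Hc0 & HX).
  exists (fun t => conjm G (c t)); split; [|split].
  - intro t; unfold conj_group; rewrite (conj_trK (tr G)) by exact H; apply Hc.
  - rewrite Hc0; apply conj_id; exact H'.
  - apply mderiv_mm_const; exact HX.
Qed.

Lemma lie_conj_group_inv (G : mat) (K : mat -> Prop) (X : mat) :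
  mm (tr G) G = id5 -> mm G (tr G) = id5 ->
  lie (conj_group G K) X -> lie K (conjm (tr G) X).
Proof.
  intros H H' (c & Hc & Hc0 & HX).
  exists (fun t => conjm (tr G) (c t)); split; [|split].
  - intro t; apply Hc.
  - rewrite Hc0; apply conj_id; exact H.
  - apply mderiv_mm_const; exact HX.
Qed.

Lemma tact_tadd (G : mat) (a b : tv) : tact G (tadd a b) = tadd (tact G a) (tact G b).
Proof.
  unfold tact, tadd; simpl; rewrite conj_add; f_equal.
  apply vec_ext; intro i; unfold mv, sum5; ring.
Qed.

Lemma tact_tscale (G : mat) (c : R) (a : tv) : tact G (tscale c a) = tscale c (tact G a).
Proof.
  unfold tact, tscale; simpl; rewrite conj_scale; f_equal.
  apply vec_ext; intro i; unfold mv, sum5; ring.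
Qed.

Lemma tact_tzero (G : mat) : tact G tzero = tzero.
Proof.
  unfold tact, tzero; simpl; f_equal.
  - apply vec_ext; intro i; unfold mv, sum5; ring.
  - unfold conjm; rewrite mm_zmat_r, mm_zmat_l; reflexivity.
Qed.

Lemma tact_trK (G : mat) (a : tv) : mm (tr G) G = id5 -> tact (tr G) (tact G a) = a.
Proof.
  intro H; unfold tact; simpl.
  rewrite <- mv_mm, H, mv_id, (conj_trK (tr G)) by exact H; destruct a; reflexivity.
Qed.

Lemma tdim4_act (G : mat) (K : mat -> Prop) (q : pt) :
  mm (tr G) G = id5 -> mm G (tr G) = id5 -> tdim4 K q -> tdim4 (conj_group G K) (act G q).
Proof.
  intros H H' (X1 & X2 & X3 & X4 & L1 & L2 & L3 & L4 & Hind & Hspan).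
  exists (conjm G X1), (conjm G X2), (conjm G X3), (conjm G X4).
  repeat (split; [apply lie_conj_group; assumption|]).
  rewrite !fvec_act by exact H; split.
  - intros c1 c2 c3 c4 Hc; apply Hind.
    rewrite <- !tact_tscale, <- !tact_tadd in Hc.
    apply (f_equal (tact (tr G))) in Hc.
    rewrite tact_trK, tact_tzero in Hc by exact H; exact Hc.
  - intros X HX.
    destruct (Hspan _ (lie_conj_group_inv G K X H H' HX)) as (c1 & c2 & c3 & c4 & Hc).
    exists c1, c2, c3, c4.
    rewrite <- (conj_trK G X H'), fvec_act, Hc by exact H.
    rewrite !tact_tadd, !tact_tscale; reflexivity.
Qed.

Lemma phi_conj_group (G : mat) (lam : R) (K : mat -> Prop) (q : pt) :
  mm (tr G) G = id5 -> mm G (tr G) = id5 ->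
  (forall X Y Z, lie K X -> lie K Y -> lie K Z ->
     phi lam q (fvec X q) (fvec Y q) (fvec Z q) = 0) ->
  forall X Y Z, lie (conj_group G K) X -> lie (conj_group G K) Y -> lie (conj_group G K) Z ->
     phi lam (act G q) (fvec X (act G q)) (fvec Y (act G q)) (fvec Z (act G q)) = 0.
Proof.
  intros H H' Hphi X Y Z HX HY HZ.
  rewrite <- (conj_trK G X H'), <- (conj_trK G Y H'), <- (conj_trK G Z H').
  rewrite !fvec_act, phi_act by assumption.
  apply Hphi; apply lie_conj_group_inv; assumption.
Qed.

(** * Anti-self-dual forms *)

(** The signed 4x4 sub-Pfaffians of a skew [A], that is, the dual vector of the 4-form A ∧ A / 2. *)
Definition pfaff (A : mat) : vec := fun m =>
  / 8 * sum5 (fun i => sum5 (fun j => sum5 (fun k => sum5 (fun l =>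
    eps5 m i j k l * A i j * A k l)))).

(** Ten free parameters for a skew matrix: after [skewmatE], claims about skew matrices become
    polynomial identities for [ring]. *)
Definition skewmat (a01 a02 a03 a04 a12 a13 a14 a23 a24 a34 : R) : mat := fun i j =>
  nth (idx j) (nth (idx i)
    [[0; a01; a02; a03; a04]; [- a01; 0; a12; a13; a14]; [- a02; - a12; 0; a23; a24];
     [- a03; - a13; - a23; 0; a34]; [- a04; - a14; - a24; - a34; 0]] nil) 0.

Lemma skewmatE (A : mat) :
  (forall i j, A i j = - A j i) ->
  A = skewmat (A f0 f1) (A f0 f2) (A f0 f3) (A f0 f4) (A f1 f2) (A f1 f3) (A f1 f4)
              (A f2 f3) (A f2 f4) (A f3 f4).
Proof.
  intro H; apply mat_ext; intros i j.
  assert (D : forall i, A i i = 0) by (intro k; pose proof (H k k); lra).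
  cases5 i; cases5 j; unfold skewmat; simpl; first [reflexivity | apply D | apply H].
Qed.

Ltac eps_simpl := unfold sum5, eps5, eps, skewmat; simpl.

(** Five-dimensional form of the fact that a skew 4x4 matrix times its Hodge dual is the scalar -Pf.
    It is linear in [x] and quadratic in [A], and is checked entry by entry. *)
Lemma hodge_skew_mul (x : vec) (A : mat) (i j : I5) :
  (forall i j, A i j = - A j i) ->
  mm A (hodge x A) i j = x i * pfaff A j - dot x (pfaff A) * id5 i j.
Proof.
  intro H; rewrite (skewmatE A H).
  generalize (A f0 f1) (A f0 f2) (A f0 f3) (A f0 f4) (A f1 f2) (A f1 f3) (A f1 f4)
              (A f2 f3) (A f2 f4) (A f3 f4); clear A H; intros a01 a02 a03 a04 a12 a13 a14 a23 a24 a34.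
  assert (HP : forall m, pfaff (skewmat a01 a02 a03 a04 a12 a13 a14 a23 a24 a34) m =
     nth (idx m) [a12 * a34 - a13 * a24 + a14 * a23; - (a02 * a34 - a03 * a24 + a04 * a23);
       a01 * a34 - a03 * a14 + a04 * a13; - (a01 * a24 - a02 * a14 + a04 * a12);
       a01 * a23 - a02 * a13 + a03 * a12] 0).
  { intro m; cases5 m; unfold pfaff; eps_simpl; field. }
  assert (HH : hodge x (skewmat a01 a02 a03 a04 a12 a13 a14 a23 a24 a34) =
    skewmat (x f2 * a34 - x f3 * a24 + x f4 * a23)
     (- (x f1 * a34 - x f3 * a14 + x f4 * a13))
     (x f1 * a24 - x f2 * a14 + x f4 * a12)
     (- (x f1 * a23 - x f2 * a13 + x f3 * a12))
     (x f0 * a34 - x f3 * a04 + x f4 * a03)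
     (- (x f0 * a24 - x f2 * a04 + x f4 * a02))
     (x f0 * a23 - x f2 * a03 + x f3 * a02)
     (x f0 * a14 - x f1 * a04 + x f4 * a01)
     (- (x f0 * a13 - x f1 * a03 + x f3 * a01))
     (x f0 * a12 - x f1 * a02 + x f2 * a01)).
  { apply mat_ext; intros a b; cases5 a; cases5 b; unfold hodge; eps_simpl; field. }
  rewrite HH; unfold dot, mm, sum5; rewrite !HP.
  cases5 i; cases5 j; unfold skewmat, id5; simpl; ring.
Qed.

(** Anti-self-duality turns the previous identity into A^2 = <x, P> - x P^T with P = [pfaff A].
    Symmetry of A^2 makes P parallel to x, and the trace identifies the factor. Thus a nonzero [A]
    is r times a complex structure on the tangent space. *)
Lemma asd_sqr (x : vec) (A : mat) :
  inE (x, A) -> forall i j, mm A A i j = - r2 A * projx x i j.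
Proof.
  intros (Hx & Hs & HAx & Hh).
  assert (Hsq : forall i j, mm A A i j = dot x (pfaff A) * id5 i j - x i * pfaff A j).
  { intros i j.
    transitivity (- mm A (hodge x A) i j); [|rewrite hodge_skew_mul by exact Hs; ring].
    unfold mm, sum5; rewrite !Hh; ring. }
  assert (Hsym : forall i j, x i * pfaff A j = x j * pfaff A i).
  { intros i j.
    assert (E : mm A A i j = mm A A j i).
    { unfold mm, sum5; rewrite !(Hs i), !(Hs j).
      rewrite (Hs f0 i), (Hs f1 i), (Hs f2 i), (Hs f3 i), (Hs f4 i),
        (Hs f0 j), (Hs f1 j), (Hs f2 j), (Hs f3 j), (Hs f4 j); ring. }
    rewrite !Hsq in E.
    assert (E' : id5 i j = id5 j i) by (clear; cases5 i; cases5 j; reflexivity).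
    rewrite E' in E; lra. }
  assert (HP : forall j, pfaff A j = dot x (pfaff A) * x j).
  { intro j; transitivity (dot x x * pfaff A j); [rewrite Hx; ring|].
    transitivity (sum5 (fun i => x i * (x i * pfaff A j))); [unfold dot, sum5; ring|].
    unfold sum5; rewrite (Hsym f0 j), (Hsym f1 j), (Hsym f2 j), (Hsym f3 j), (Hsym f4 j).
    unfold dot, sum5; ring. }
  assert (Ht : r2 A = - dot x (pfaff A)).
  { transitivity (- / 4 * mtrace (mm A A)).
    - unfold r2, mtrace, mm, sum5.
      rewrite (Hs f1 f0), (Hs f2 f0), (Hs f3 f0), (Hs f4 f0), (Hs f2 f1), (Hs f3 f1),
        (Hs f4 f1), (Hs f3 f2), (Hs f4 f2), (Hs f4 f3).
      assert (D : forall i, A i i = 0) by (intro k; pose proof (Hs k k); lra).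
      rewrite !D; ring.
    - unfold mtrace, sum5; rewrite !Hsq.
      unfold dot, sum5, id5; simpl; field. }
  intros i j; rewrite Hsq, HP, Ht; unfold projx; ring.
Qed.

(** * Adapted frames *)

(** Fewer equations than unknowns leave a nonzero solution. This is the base case; the next two
    lemmas eliminate the first unknown, pivoting on a nonzero coefficient. *)
Lemma hom_2_1 (a b : R) : exists x y, (x <> 0 \/ y <> 0) /\ a * x + b * y = 0.
Proof.
  destruct (Req_dec a 0) as [->|Ha].
  - exists 1, 0; split; [left; lra | ring].
  - exists (- b), a; split; [right; exact Ha | ring].
Qed.

Lemma hom_3_2 (a b c a' b' c' : R) :
  exists x y z, (x <> 0 \/ y <> 0 \/ z <> 0) /\
    a * x + b * y + c * z = 0 /\ a' * x + b' * y + c' * z = 0.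
Proof.
  destruct (Req_dec a 0) as [->|Ha]; [destruct (Req_dec a' 0) as [->|Ha']|].
  - exists 1, 0, 0; split; [left; lra | split; ring].
  - destruct (hom_2_1 b c) as (y & z & Hyz & E).
    exists (- (b' * y + c' * z) / a'), y, z; split; [tauto | split; [lra | field; exact Ha']].
  - destruct (hom_2_1 (b' - a' * b / a) (c' - a' * c / a)) as (y & z & Hyz & E).
    exists (- (b * y + c * z) / a), y, z; split; [tauto | split; [field; exact Ha|]].
    rewrite <- E; field; exact Ha.
Qed.

Lemma hom_4_3 (a b c d a' b' c' d' a'' b'' c'' d'' : R) :
  exists x y z t, (x <> 0 \/ y <> 0 \/ z <> 0 \/ t <> 0) /\
    a * x + b * y + c * z + d * t = 0 /\ a' * x + b' * y + c' * z + d' * t = 0 /\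
    a'' * x + b'' * y + c'' * z + d'' * t = 0.
Proof.
  destruct (Req_dec a 0) as [->|Ha];
    [destruct (Req_dec a' 0) as [->|Ha']; [destruct (Req_dec a'' 0) as [->|Ha'']|]|].
  - exists 1, 0, 0, 0; split; [left; lra | repeat split; ring].
  - destruct (hom_3_2 b c d b' c' d') as (y & z & t & Hn & E & E').
    exists (- (b'' * y + c'' * z + d'' * t) / a''), y, z, t.
    split; [tauto | repeat split; [lra | lra | field; exact Ha'']].
  - destruct (hom_3_2 b c d (b'' - a'' * b' / a') (c'' - a'' * c' / a') (d'' - a'' * d' / a'))
      as (y & z & t & Hn & E & E').
    exists (- (b' * y + c' * z + d' * t) / a'), y, z, t.
    split; [tauto | repeat split; [lra | field; exact Ha' |]].
    rewrite <- E'; field; exact Ha'.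
  - destruct (hom_3_2 (b' - a' * b / a) (c' - a' * c / a) (d' - a' * d / a)
      (b'' - a'' * b / a) (c'' - a'' * c / a) (d'' - a'' * d / a))
      as (y & z & t & Hn & E & E').
    exists (- (b * y + c * z + d * t) / a), y, z, t.
    split; [tauto | repeat split; [field; exact Ha | |]];
      [rewrite <- E | rewrite <- E']; field; exact Ha.
Qed.

(** Three linear conditions on the first four coordinates leave a nonzero solution; the fifth
    coordinate is set to 0 and the result is normalised. *)
Lemma orthogonal_unit_vector (u v w : vec) :
  exists e, dot e e = 1 /\ dot e u = 0 /\ dot e v = 0 /\ dot e w = 0.
Proof.
  destruct (hom_4_3 (u f0) (u f1) (u f2) (u f3) (v f0) (v f1) (v f2) (v f3)
    (w f0) (w f1) (w f2) (w f3)) as (x & y & z & t & Hn & Hu & Hv & Hw).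
  set (n := x ^ 2 + y ^ 2 + z ^ 2 + t ^ 2).
  assert (Hpos : 0 < n)
    by (unfold n; destruct Hn as [H|[H|[H|H]]]; apply Rsqr_pos_lt in H; unfold Rsqr in H; nra).
  assert (Hs : sqrt n * sqrt n = n) by (apply sqrt_sqrt; lra).
  assert (Hs0 : sqrt n <> 0) by (intro E; rewrite E in Hs; lra).
  exists (fun i => nth (idx i) [x; y; z; t; 0] 0 / sqrt n).
  unfold dot, sum5; simpl; repeat split.
  (* The eleventh occurrence of [n] is the numerator on the right; those under square roots stay
     folded. *)
  - transitivity (n / (sqrt n * sqrt n)); [unfold n at 11; field; exact Hs0|].
    rewrite Hs; field; lra.
  - transitivity ((u f0 * x + u f1 * y + u f2 * z + u f3 * t) / sqrt n); [field; exact Hs0|].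
    rewrite Hu; field; exact Hs0.
  - transitivity ((v f0 * x + v f1 * y + v f2 * z + v f3 * t) / sqrt n); [field; exact Hs0|].
    rewrite Hv; field; exact Hs0.
  - transitivity ((w f0 * x + w f1 * y + w f2 * z + w f3 * t) / sqrt n); [field; exact Hs0|].
    rewrite Hw; field; exact Hs0.
Qed.

(* The point r omega_3 in the fibre over e_5. *)
Definition std_pt (r : R) : pt :=
  (fun i => id5 i f4, skewmat 0 0 r 0 (- r) 0 0 0 0 0).

Definition vscale (c : R) (u : vec) : vec := fun i => c * u i.

Lemma dot_vscale_r (c : R) (u v : vec) : dot u (vscale c v) = c * dot u v.
Proof. unfold dot, vscale, sum5; ring. Qed.

Lemma mv_vscale (A : mat) (c : R) (u : vec) : mv A (vscale c u) = vscale c (mv A u).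
Proof. apply vec_ext; intro i; unfold mv, vscale, sum5; ring. Qed.

Lemma vscale_vscale (a b : R) (u : vec) : vscale a (vscale b u) = vscale (a * b) u.
Proof. apply vec_ext; intro i; unfold vscale; ring. Qed.

Lemma vscale_1 (u : vec) : vscale 1 u = u.
Proof. apply vec_ext; intro i; unfold vscale; ring. Qed.

Lemma dot_skew (A : mat) (u v : vec) :
  (forall i j, A i j = - A j i) -> dot u (mv A v) = - dot v (mv A u).
Proof. intro H; rewrite (skewmatE A H); unfold dot, mv, sum5, skewmat; simpl; ring. Qed.

(* The frame is e, f, A f / r, - A e / r, x with e orthogonal to x and f orthogonal to x, e, A e. *)
Lemma adapted_frame (x : vec) (A : mat) :
  inE (x, A) -> A <> zmat ->
  exists G r, r <> 0 /\ mm G (tr G) = id5 /\ act G (x, A) = std_pt r.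
Proof.
  intros HE HA.
  pose proof (asd_sqr x A HE) as Hsq.
  destruct HE as (Hx & Hs & HAx & _).
  assert (Hr2 : 0 < r2 A).
  { destruct (Rle_lt_or_eq_dec 0 (r2 A)) as [H|H]; [|exact H|].
    - unfold r2; apply Rmult_le_pos; [lra|].
      apply sum5_ge0; intro; apply sum5_ge0; intro; apply pow2_ge_0.
    - exfalso; apply HA, frob_eq0; unfold r2 in H; lra. }
  set (r := sqrt (r2 A)).
  assert (Hrr : r * r = r2 A) by (apply sqrt_sqrt; lra).
  assert (Hr : r <> 0) by (intro E; rewrite E in Hrr; lra).
  assert (HAx' : mv A x = vscale 0 x)
    by (apply vec_ext; intro i; rewrite HAx; unfold vscale; ring).
  (* By [asd_sqr], A / r squares to -1 on the complement of [x]. *)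
  assert (HAA : forall v, dot v x = 0 -> mv A (mv A v) = vscale (- (r * r)) v).
  { intros v Hv; rewrite Hrr; apply vec_ext; intro i; rewrite <- mv_mm.
    unfold mv; unfold sum5 at 1; rewrite !Hsq; unfold vscale.
    transitivity (- r2 A * (mv id5 v i - x i * dot v x));
      [unfold mv, dot, projx, sum5; ring | rewrite Hv, mv_id; ring]. }
  (* Only orthogonality to [x] is wanted, so [x] fills all three slots. *)
  destruct (orthogonal_unit_vector x x x) as (e1 & H11 & H1x & _ & _).
  set (e4 := vscale (- / r) (mv A e1)).
  destruct (orthogonal_unit_vector x e1 e4) as (e2 & H22 & H2x & H21 & H24).
  set (e3 := vscale (/ r) (mv A e2)).
  assert (A1 : mv A e1 = vscale (- r) e4).
  { unfold e4; rewrite vscale_vscale; replace (- r * - / r) with 1 by (field; exact Hr).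
    rewrite vscale_1; reflexivity. }
  assert (A2 : mv A e2 = vscale r e3).
  { unfold e3; rewrite vscale_vscale; replace (r * / r) with 1 by (field; exact Hr).
    rewrite vscale_1; reflexivity. }
  assert (A3 : mv A e3 = vscale (- r) e2).
  { unfold e3; rewrite mv_vscale, HAA, vscale_vscale by exact H2x.
    f_equal; field; exact Hr. }
  assert (A4 : mv A e4 = vscale r e1).
  { unfold e4; rewrite mv_vscale, HAA, vscale_vscale by exact H1x.
    f_equal; field; exact Hr. }
  clearbody e3 e4.
  assert (canc : forall s, r * s = 0 -> s = 0)
    by (intros s E; destruct (Rmult_integral _ _ E); [contradiction | assumption]).
  assert (canc1 : forall s, r * s = r -> s = 1)
    by (intros s E; apply (Rmult_eq_reg_l r); [lra | exact Hr]).
  (* Skewness of [A] on pairs of frame vectors with known images yields the orthonormality relations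
     not built into the choice of [e1] and [e2]. *)
  pose proof (dot_skew A e1 e1 Hs) as S11; rewrite A1, !dot_vscale_r in S11.
  pose proof (dot_skew A e2 e2 Hs) as S22; rewrite A2, !dot_vscale_r in S22.
  pose proof (dot_skew A e1 e4 Hs) as S14; rewrite A1, A4, !dot_vscale_r in S14.
  pose proof (dot_skew A e2 e3 Hs) as S23; rewrite A2, A3, !dot_vscale_r in S23.
  pose proof (dot_skew A e1 e2 Hs) as S12; rewrite A1, A2, !dot_vscale_r in S12.
  pose proof (dot_skew A e2 e4 Hs) as S24; rewrite A2, A4, !dot_vscale_r in S24.
  pose proof (dot_skew A x e1 Hs) as Sx1; rewrite HAx', A1, !dot_vscale_r in Sx1.
  pose proof (dot_skew A x e2 Hs) as Sx2; rewrite HAx', A2, !dot_vscale_r in Sx2.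
  rewrite (dot_sym e2 e1) in *; rewrite (dot_sym e4 e3) in *.
  assert (H14 : dot e1 e4 = 0) by (apply canc; lra).
  assert (H23 : dot e2 e3 = 0) by (apply canc; lra).
  assert (H44 : dot e4 e4 = 1) by (apply canc1; rewrite H11 in S14; lra).
  assert (H33 : dot e3 e3 = 1) by (apply canc1; rewrite H22 in S23; lra).
  assert (H13 : dot e1 e3 = 0) by (apply canc; rewrite H24 in S12; lra).
  assert (H34 : dot e3 e4 = 0) by (apply canc; rewrite H21 in S24; lra).
  assert (H4x : dot x e4 = 0) by (apply canc; lra).
  assert (H3x : dot x e3 = 0) by (apply canc; lra).
  set (G := fun i : I5 => nth (idx i) [e1; e2; e3; e4; x] x).
  exists (G : mat), r; split; [exact Hr|].
  assert (HG : forall i j, dot (G i) (G j) = id5 i j).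
  { intros i j; cases5 i; cases5 j; unfold G; simpl; unfold id5; simpl;
      first [assumption | rewrite dot_sym; assumption]. }
  split.
  - apply mat_ext; intros i j; exact (HG i j).
  - unfold act, std_pt; simpl; f_equal.
    + apply vec_ext; intro i; exact (HG i f4).
    + apply mat_ext; intros i j.
      transitivity (dot (G i) (mv A (G j)));
        [unfold dot, mv, mm, tr, sum5; ring|].
      assert (HGA : mv A (G j) = nth (idx j)
        [vscale (- r) (G f3); vscale r (G f2); vscale (- r) (G f1); vscale r (G f0);
         vscale 0 (G f4)] x)
        by (cases5 j; unfold G; simpl; assumption).
      rewrite HGA; clear HGA.
      cases5 j; simpl nth; rewrite dot_vscale_r, HG; cases5 i;
        unfold skewmat, id5; simpl; ring.
Qed.

(** * The complex volume form at the standard point *)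

(* At [std_pt r] the fundamental field of M has horizontal part (coord 0, ..., coord 3) and
   vertical part r (coord 5 omega_1 - coord 4 omega_2). *)
Definition coord (k : nat) (M : mat) : R :=
  nth k [M f0 f4; M f1 f4; M f2 f4; M f3 f4; M f0 f1 - M f2 f3; M f0 f2 + M f1 f3] 0.

(** [om1], [om2], [om3] are the forms omega_1, omega_2, omega_3 evaluated on horizontal parts. *)
Definition om1 (X Y : mat) : R :=
  coord 0 X * coord 1 Y - coord 1 X * coord 0 Y - coord 2 X * coord 3 Y + coord 3 X * coord 2 Y.
Definition om2 (X Y : mat) : R :=
  coord 0 X * coord 2 Y - coord 2 X * coord 0 Y + coord 1 X * coord 3 Y - coord 3 X * coord 1 Y.
Definition om3 (X Y : mat) : R :=
  coord 0 X * coord 3 Y - coord 3 X * coord 0 Y - coord 1 X * coord 2 Y + coord 2 X * coord 1 Y.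

(* Omega = (coord 5 + i coord 4) /\ (omega_1 + i omega_2). *)
Definition ReOm (X Y Z : mat) : R :=
  coord 5 X * om1 Y Z - coord 4 X * om2 Y Z +
  (coord 5 Y * om1 Z X - coord 4 Y * om2 Z X) +
  (coord 5 Z * om1 X Y - coord 4 Z * om2 X Y).
Definition ImOm (X Y Z : mat) : R :=
  coord 4 X * om1 Y Z + coord 5 X * om2 Y Z +
  (coord 4 Y * om1 Z X + coord 5 Y * om2 Z X) +
  (coord 4 Z * om1 X Y + coord 5 Z * om2 X Y).

(** The vertical part is the projected bracket of [X] with r omega_3; it has no omega_3
    component. *)
Lemma std_vert (r : R) (X : mat) :
  (forall i j, X i j = - X j i) ->
  vert (fst (std_pt r)) (snd (fvec X (std_pt r))) =
  skewmat (r * coord 5 X) (- r * coord 4 X) 0 0 0 (- r * coord 4 X) 0 (- r * coord 5 X) 0 0.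
Proof.
  intro H; rewrite (skewmatE X H).
  generalize (X f0 f1) (X f0 f2) (X f0 f3) (X f0 f4) (X f1 f2) (X f1 f3) (X f1 f4)
              (X f2 f3) (X f2 f4) (X f3 f4); clear X H; intros.
  (* Projecting off the last basis vector erases the last row and column. *)
  assert (HP : forall M : mat, vert (fst (std_pt r)) M =
    fun i j => if orb (Nat.eqb (idx i) 4) (Nat.eqb (idx j) 4) then 0 else M i j).
  { intro M; apply mat_ext; intros i j; cases5 i; cases5 j;
    unfold vert, projx, mm, sum5, std_pt, id5; simpl; ring. }
  rewrite HP; apply mat_ext; intros i j; cases5 i; cases5 j;
    unfold fvec, std_pt, mm, tr, sum5, coord, skewmat; simpl; ring.
Qed.

Lemma std_phi (lam r : R) (X Y Z : mat) :
  r <> 0 ->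
  (forall i j, X i j = - X j i) -> (forall i j, Y i j = - Y j i) ->
  (forall i j, Z i j = - Z j i) ->
  phi lam (std_pt r) (fvec X (std_pt r)) (fvec Y (std_pt r)) (fvec Z (std_pt r)) = 0 ->
  ReOm X Y Z = 0.
Proof.
  intros Hr HX HY HZ; unfold phi; rewrite !std_vert by assumption.
  set (s := s_lam lam _).
  assert (Hs : 0 < s) by (unfold s, s_lam, Rpower; apply exp_pos).
  assert (Hv : forall M, (forall i j, M i j = - M j i) -> fst (fvec M (std_pt r)) =
    fun i => nth (idx i) [coord 0 M; coord 1 M; coord 2 M; coord 3 M; 0] 0).
  { intros M HM; assert (D : M f4 f4 = 0) by (pose proof (HM f4 f4); lra).
    apply vec_ext; intro i; cases5 i; unfold fvec, std_pt, mv, sum5, id5, coord; simpl;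
    rewrite ?D; ring. }
  rewrite !Hv by assumption; clear Hv.
  set (tri := mtrace _).
  (* The three vertical parts lie in the plane of omega_1 and omega_2, so b_1 ∧ b_2 ∧ b_3 vanishes
     on them. What remains of [phi] is 2 s r Re Omega. *)
  assert (Htri : tri = 0).
  { unfold tri, mtrace, mm, sum5, skewmat; simpl; ring. }
  rewrite Htri; intro E.
  assert (E' : 2 * s * r * ReOm X Y Z = 0).
  { rewrite <- E; unfold ReOm, om1, om2, bil, dot, mv, sum5, skewmat; simpl.
    field; lra. }
  destruct (Rmult_integral _ _ E') as [E''|]; [|assumption].
  destruct (Rmult_integral _ _ E'') as [E'''|]; [lra|contradiction].
Qed.

(** The six coordinates of a skew matrix and its fundamental field at [std_pt r] determine each
    other, so [tdim4] can be read on coordinates. *)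
Lemma std_dim4 (r : R) (K : mat -> Prop) :
  r <> 0 -> (forall g, K g -> mm (tr g) g = id5) -> tdim4 K (std_pt r) ->
  exists X1 X2 X3 X4, lie K X1 /\ lie K X2 /\ lie K X3 /\ lie K X4 /\
    (forall c1 c2 c3 c4,
      (forall k, (k < 6)%nat -> c1 * coord k X1 + c2 * coord k X2 + c3 * coord k X3 + c4 * coord k X4 = 0) ->
      c1 = 0 /\ c2 = 0 /\ c3 = 0 /\ c4 = 0) /\
    (forall X, lie K X -> exists c1 c2 c3 c4, forall k,
      coord k X = c1 * coord k X1 + c2 * coord k X2 + c3 * coord k X3 + c4 * coord k X4).
Proof.
  intros Hr HK (X1 & X2 & X3 & X4 & L1 & L2 & L3 & L4 & Hind & Hspan).
  exists X1, X2, X3, X4; repeat (split; [assumption|]); split.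
  - intros c1 c2 c3 c4 Hc; apply Hind.
    pose proof (Hc 0%nat ltac:(lia)) as Z0; pose proof (Hc 1%nat ltac:(lia)) as Z1;
    pose proof (Hc 2%nat ltac:(lia)) as Z2; pose proof (Hc 3%nat ltac:(lia)) as Z3;
    pose proof (Hc 4%nat ltac:(lia)) as Z4; pose proof (Hc 5%nat ltac:(lia)) as Z5.
    clear Hc Hind Hspan.
    set (M := fun i j => c1 * X1 i j + c2 * X2 i j + c3 * X3 i j + c4 * X4 i j).
    assert (HM : forall i j, M i j = - M j i).
    { intros i j; unfold M.
      rewrite (lie_skew K X1 HK L1 i j), (lie_skew K X2 HK L2 i j),
        (lie_skew K X3 HK L3 i j), (lie_skew K X4 HK L4 i j); ring. }
    transitivity (fvec M (std_pt r)).
    { unfold fvec, tadd, tscale, M; simpl; f_equal.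
      - apply vec_ext; intro i; unfold mv, sum5; ring.
      - apply mat_ext; intros i j; unfold mm, sum5, tr; ring. }
    (* Vanishing of all six coordinates puts [M] in the isotropy algebra u(2) of r omega_3, with
       four free entries; its fundamental field is then zero. *)
    assert (E : M = skewmat (M f0 f1) (M f0 f2) (M f0 f3) 0 (M f1 f2) (- M f0 f2) 0
                            (M f0 f1) 0 0).
    { rewrite (skewmatE M HM) at 1; unfold coord in *; simpl in *.
      f_equal; unfold M; lra. }
    rewrite E; clearbody M; generalize (M f0 f1) (M f0 f2) (M f0 f3) (M f1 f2).
    clear; intros; unfold fvec, std_pt, tzero; simpl; f_equal.
    + apply vec_ext; intro i; cases5 i; unfold mv, sum5, skewmat, id5; simpl; ring.
    + apply mat_ext; intros i j; cases5 i; cases5 j;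
        unfold mm, sum5, tr, skewmat, zmat; simpl; ring.
  - intros X HX; destruct (Hspan X HX) as (c1 & c2 & c3 & c4 & E).
    exists c1, c2, c3, c4; intro k.
    destruct (Nat.lt_ge_cases k 6) as [Hk|Hk].
    2:{ unfold coord; rewrite !nth_overflow by exact Hk; ring. }
    assert (V : forall i, X i f4 = c1 * X1 i f4 + c2 * X2 i f4 + c3 * X3 i f4 + c4 * X4 i f4).
    { intro i.
      assert (HV : forall Y, fst (fvec Y (std_pt r)) i = Y i f4)
        by (intro Y; unfold fvec, std_pt, mv, sum5, id5; simpl; ring).
      rewrite <- !HV, E; unfold tadd, tscale; simpl; ring. }
    assert (W : forall i j,
      vert (fst (std_pt r)) (snd (fvec X (std_pt r))) i j =
      c1 * vert (fst (std_pt r)) (snd (fvec X1 (std_pt r))) i j +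
      c2 * vert (fst (std_pt r)) (snd (fvec X2 (std_pt r))) i j +
      c3 * vert (fst (std_pt r)) (snd (fvec X3 (std_pt r))) i j +
      c4 * vert (fst (std_pt r)) (snd (fvec X4 (std_pt r))) i j).
    { intros i j; rewrite E; unfold vert, mm, sum5, tadd, tscale; simpl; ring. }
    rewrite !std_vert in W by (eapply lie_skew; eassumption).
    (* These two entries of the vertical part are r times [coord 5] and -r times [coord 4]. *)
    pose proof (W f0 f1) as W5; pose proof (W f0 f2) as W4; clear W E.
    unfold skewmat in W4, W5; simpl nth in W4, W5.
    do 6 (destruct k as [|k];
      [first [unfold coord; simpl; apply V | apply (Rmult_eq_reg_l r); [lra|exact Hr]]|]); lia.
Qed.

(* Contracting X1 /\ X2 /\ X3 /\ X4 with Im Omega is, up to the complex structure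
   (the index c and the sign), contracting it with Re Omega. *)
Lemma ImOm_ReOm_dual (X1 X2 X3 X4 : mat) (k : nat) :
  (k < 6)%nat ->
  ImOm X2 X3 X4 * coord k X1 + - ImOm X1 X3 X4 * coord k X2 +
  ImOm X1 X2 X4 * coord k X3 + - ImOm X1 X2 X3 * coord k X4 =
  let c := nth k [3; 2; 1; 0; 5; 4]%nat 0%nat in
  (-1) ^ k * (ReOm X2 X3 X4 * coord c X1 - ReOm X1 X3 X4 * coord c X2 +
  ReOm X1 X2 X4 * coord c X3 - ReOm X1 X2 X3 * coord c X4).
Proof.
  intro Hk.
  do 6 (destruct k as [|k]; [unfold ImOm, ReOm, om1, om2; simpl nth; simpl pow; cbv zeta; ring|]); lia.
Qed.

(** * The exterior derivative of Im Omega *)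

(** The horizontal volume form in Laplace expansion; [vol2] below is the vertical area form. *)
Definition det4 (X Y Z T : mat) : R :=
  let m2 i j A B := coord i A * coord j B - coord j A * coord i B in
  m2 0%nat 1%nat X Y * m2 2%nat 3%nat Z T - m2 0%nat 2%nat X Y * m2 1%nat 3%nat Z T
  + m2 0%nat 3%nat X Y * m2 1%nat 2%nat Z T + m2 1%nat 2%nat X Y * m2 0%nat 3%nat Z T
  - m2 1%nat 3%nat X Y * m2 0%nat 2%nat Z T + m2 2%nat 3%nat X Y * m2 0%nat 1%nat Z T.

Definition vol2 (X Y : mat) : R := coord 4 X * coord 5 Y - coord 5 X * coord 4 Y.

(* The exterior derivative of Im Omega pulled back to SO(5), in left-invariant terms. *)
Lemma d_ImOm (X Y Z T : mat) :
  (forall i j, X i j = - X j i) -> (forall i j, Y i j = - Y j i) ->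
  (forall i j, Z i j = - Z j i) -> (forall i j, T i j = - T j i) ->
  - ImOm (bracket X Y) Z T + ImOm (bracket X Z) Y T - ImOm (bracket X T) Y Z
  - ImOm (bracket Y Z) X T + ImOm (bracket Y T) X Z - ImOm (bracket Z T) X Y =
  - 4 * det4 X Y Z T + 2 * (om3 X Y * vol2 Z T - om3 X Z * vol2 Y T + om3 X T * vol2 Y Z
    + om3 Y Z * vol2 X T - om3 Y T * vol2 X Z + om3 Z T * vol2 X Y).
Proof.
  intros HX HY HZ HT.
  (* [s3] completes [coord 4] and [coord 5] to the anti-self-dual part of the so(4) component; [p1],
     [p2], [p3] give its self-dual part. They enter the brackets but cancel in the alternating sum,
     since Im Omega is invariant under the isotropy group U(2). *)
  set (s3 := fun M : mat => M f0 f3 - M f1 f2).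
  set (p1 := fun M : mat => M f0 f1 + M f2 f3).
  set (p2 := fun M : mat => M f0 f2 - M f1 f3).
  set (p3 := fun M : mat => M f0 f3 + M f1 f2).
  (* The structure equations of so(5) in these coordinates. *)
  assert (Hb : forall A B k, (forall i j, A i j = - A j i) -> (forall i j, B i j = - B j i) ->
    coord k (bracket A B) = nth k (let h A B :=
      [ (p1 A + coord 4 A) * coord 1 B + (p2 A + coord 5 A) * coord 2 B + (p3 A + s3 A) * coord 3 B;
        - (p1 A + coord 4 A) * coord 0 B + (p3 A - s3 A) * coord 2 B + (coord 5 A - p2 A) * coord 3 B;
        - (p2 A + coord 5 A) * coord 0 B - (p3 A - s3 A) * coord 1 B + (p1 A - coord 4 A) * coord 3 B;
        - (p3 A + s3 A) * coord 0 B - (coord 5 A - p2 A) * coord 1 B - (p1 A - coord 4 A) * coord 2 B] in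
      [(nth 0 (h A B) 0 - nth 0 (h B A) 0) / 2; (nth 1 (h A B) 0 - nth 1 (h B A) 0) / 2;
       (nth 2 (h A B) 0 - nth 2 (h B A) 0) / 2; (nth 3 (h A B) 0 - nth 3 (h B A) 0) / 2;
       - om1 A B + coord 5 A * s3 B - s3 A * coord 5 B;
       - om2 A B - coord 4 A * s3 B + s3 A * coord 4 B]) 0).
  { intros A B k HA HB; rewrite (skewmatE A HA), (skewmatE B HB).
    do 6 (destruct k as [|k];
      [unfold om1, om2, bracket, mm, sum5, skewmat, s3, p1, p2, p3, coord; simpl; field|]).
    unfold coord; rewrite !nth_overflow by (simpl; lia); reflexivity. }
  unfold ImOm; unfold om1, om2; rewrite !Hb by assumption; simpl nth.
  unfold det4, om1, om2, om3, vol2; clearbody s3 p1 p2 p3; field.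
Qed.

(** * From Re Omega to Im Omega on the tangent space and on brackets *)

Lemma ImOm_cycle (X Y Z : mat) : ImOm X Y Z = ImOm Y Z X.
Proof. unfold ImOm, om1, om2; ring. Qed.

Lemma ImOm_swap (X Y Z : mat) : ImOm X Y Z = - ImOm Y X Z.
Proof. unfold ImOm, om1, om2; ring. Qed.

Lemma ImOm_diag (X Y : mat) : ImOm X X Y = 0.
Proof. unfold ImOm, om1, om2; ring. Qed.

Lemma ImOm_span (X X1 X2 X3 X4 Y Z : mat) (c1 c2 c3 c4 : R) :
  (forall k, coord k X = c1 * coord k X1 + c2 * coord k X2 + c3 * coord k X3 + c4 * coord k X4) ->
  ImOm X Y Z = c1 * ImOm X1 Y Z + c2 * ImOm X2 Y Z + c3 * ImOm X3 Y Z + c4 * ImOm X4 Y Z.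
Proof. intro H; unfold ImOm, om1, om2; rewrite !H; ring. Qed.

(* The real part vanishes only on complex subspaces. *)
Lemma ImOm_vanishes (L : mat -> Prop) (X1 X2 X3 X4 : mat) :
  L X1 -> L X2 -> L X3 -> L X4 ->
  (forall c1 c2 c3 c4,
    (forall k, (k < 6)%nat -> c1 * coord k X1 + c2 * coord k X2 + c3 * coord k X3 + c4 * coord k X4 = 0) ->
    c1 = 0 /\ c2 = 0 /\ c3 = 0 /\ c4 = 0) ->
  (forall X, L X -> exists c1 c2 c3 c4, forall k,
    coord k X = c1 * coord k X1 + c2 * coord k X2 + c3 * coord k X3 + c4 * coord k X4) ->
  (forall X Y Z, L X -> L Y -> L Z -> ReOm X Y Z = 0) ->
  forall X Y Z, L X -> L Y -> L Z -> ImOm X Y Z = 0.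
Proof.
  intros L1 L2 L3 L4 Hind Hspan HRe.
  (* These coefficients contract X1 ∧ X2 ∧ X3 ∧ X4 with Im Omega. By duality every coordinate of the
     combination is built from values of Re Omega, hence is 0, and independence kills the
     coefficients. *)
  destruct (Hind (ImOm X2 X3 X4) (- ImOm X1 X3 X4) (ImOm X1 X2 X4) (- ImOm X1 X2 X3))
    as (E234 & E134 & E124 & E123).
  { intros k Hk; rewrite ImOm_ReOm_dual by exact Hk; cbv zeta.
    rewrite !HRe by assumption; ring. }
  assert (E134' : ImOm X1 X3 X4 = 0) by lra; assert (E123' : ImOm X1 X2 X3 = 0) by lra.
  (* Alternation extends the vanishing to all triples of basis elements; linearity, one slot at a
     time, extends it to [L]. *)
  assert (F : forall i j k, In i [X1; X2; X3; X4] -> In j [X1; X2; X3; X4] ->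
    In k [X1; X2; X3; X4] -> ImOm i j k = 0).
  { assert (D1 : forall X Y, ImOm X Y X = 0)
      by (intros; rewrite ImOm_cycle, ImOm_cycle; apply ImOm_diag).
    assert (D2 : forall X Y, ImOm X Y Y = 0)
      by (intros; rewrite ImOm_cycle; apply ImOm_diag).
    assert (S : forall X Y Z, ImOm X Y Z = 0 -> ImOm Y X Z = 0)
      by (intros X Y Z E; rewrite ImOm_swap, E; ring).
    assert (T : forall X Y Z, ImOm X Y Z = 0 -> ImOm Z X Y = 0)
      by (intros X Y Z E; rewrite ImOm_cycle; exact E).
    intros i j k [<-|[<-|[<-|[<-|[]]]]] [<-|[<-|[<-|[<-|[]]]]] [<-|[<-|[<-|[<-|[]]]]];
      first [apply ImOm_diag | apply D1 | apply D2 | assumption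
            | apply S; assumption | apply T; assumption | apply T, T; assumption
            | apply S, T; assumption | apply S, T, T; assumption]. }
  intros X Y Z HX HY HZ.
  assert (F1 : forall i j, In i [X1; X2; X3; X4] -> In j [X1; X2; X3; X4] -> ImOm Z i j = 0).
  { intros i j Hi Hj; destruct (Hspan Z HZ) as (c1 & c2 & c3 & c4 & Hc).
    rewrite (ImOm_span _ _ _ _ _ _ _ _ _ _ _ Hc), !F by (simpl; tauto); ring. }
  assert (F2 : forall i, In i [X1; X2; X3; X4] -> ImOm Y Z i = 0).
  { intros i Hi; destruct (Hspan Y HY) as (c1 & c2 & c3 & c4 & Hc).
    rewrite (ImOm_span _ _ _ _ _ _ _ _ _ _ _ Hc).
    rewrite !(ImOm_cycle _ Z i), !F1 by (simpl; tauto); ring. }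
  destruct (Hspan X HX) as (c1 & c2 & c3 & c4 & Hc).
  rewrite (ImOm_span _ _ _ _ _ _ _ _ _ _ _ Hc), !(ImOm_cycle _ Y Z), !F2 by (simpl; tauto); ring.
Qed.

Lemma coord_functional_bracket (K : mat -> Prop) (F : mat -> R) (a0 a1 a2 a3 a4 a5 : R) (X Y : mat) :
  subgroup K -> (forall g, K g -> mm (tr g) g = id5) ->
  (forall M, F M = a0 * coord 0 M + a1 * coord 1 M + a2 * coord 2 M + a3 * coord 3 M
                   + a4 * coord 4 M + a5 * coord 5 M) ->
  (forall Z, lie K Z -> F Z = 0) ->
  lie K X -> lie K Y -> F (bracket X Y) = 0.
Proof.
  intros HS HK HF HZ HX HY.
  (* The coefficients sit above the diagonal; the absent fifth row reads as 0 by the default of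
     [nth]. *)
  set (C := fun i j : I5 => nth (idx j) (nth (idx i)
    [[0; a4; a5; 0; a0]; [0; 0; 0; a5; a1]; [0; 0; 0; - a4; a2]; [0; 0; 0; 0; a3]] nil) 0).
  assert (E : forall M, F M = pairing C M).
  { intro M; rewrite HF; unfold pairing, C, sum5, coord; simpl; ring. }
  rewrite E; apply (pairing_bracket K); auto.
  intros Z H; rewrite <- E; auto.
Qed.

(** Membership of brackets in [lie K] is avoided: M ↦ [ImOm M Z T] is a combination of coordinates
    that vanishes on [lie K], so it vanishes on brackets as well. *)
Lemma ImOm_bracket (K : mat -> Prop) (X Y Z T : mat) :
  subgroup K -> (forall g, K g -> mm (tr g) g = id5) ->
  (forall X Y Z, lie K X -> lie K Y -> lie K Z -> ImOm X Y Z = 0) ->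
  lie K X -> lie K Y -> lie K Z -> lie K T -> ImOm (bracket X Y) Z T = 0.
Proof.
  intros HS HK HIm HX HY HZ HT.
  apply (coord_functional_bracket K (fun M => ImOm M Z T)
    (- coord 4 Z * coord 1 T - coord 5 Z * coord 2 T + coord 4 T * coord 1 Z + coord 5 T * coord 2 Z)
    (coord 4 Z * coord 0 T - coord 5 Z * coord 3 T - coord 4 T * coord 0 Z + coord 5 T * coord 3 Z)
    (coord 4 Z * coord 3 T + coord 5 Z * coord 0 T - coord 4 T * coord 3 Z - coord 5 T * coord 0 Z)
    (- coord 4 Z * coord 2 T + coord 5 Z * coord 1 T + coord 4 T * coord 2 Z - coord 5 T * coord 1 Z)
    (om1 Z T) (om2 Z T)); auto.
  intro M; unfold ImOm, om1, om2; ring.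
Qed.

(** * Orbits off the zero section *)

(** Linearity on four-term combinations, the shape in which [pick_element] builds its elements. *)
Definition linear_form (f : mat -> R) : Prop :=
  forall c1 c2 c3 c4 X1 X2 X3 X4,
    f (fun i j => c1 * X1 i j + c2 * X2 i j + c3 * X3 i j + c4 * X4 i j) =
    c1 * f X1 + c2 * f X2 + c3 * f X3 + c4 * f X4.

Lemma linear_coord (k : nat) : linear_form (coord k).
Proof.
  intros c1 c2 c3 c4 X1 X2 X3 X4.
  do 6 (destruct k as [|k]; [unfold coord; simpl; ring|]).
  unfold coord; rewrite !nth_overflow by (simpl; lia); ring.
Qed.

Lemma linear_om3 (X : mat) : linear_form (om3 X).
Proof. intros c1 c2 c3 c4 X1 X2 X3 X4; unfold om3; rewrite !linear_coord; ring. Qed.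

(** The horizontal inner product, joined to [om1], [om2], [om3] to give four coordinates adapted to
    a vector [U]. *)
Definition om0 (X Y : mat) : R :=
  coord 0 X * coord 0 Y + coord 1 X * coord 1 Y + coord 2 X * coord 2 Y + coord 3 X * coord 3 Y.

Lemma linear_om0 (X : mat) : linear_form (om0 X).
Proof. intros c1 c2 c3 c4 X1 X2 X3 X4; unfold om0; rewrite !linear_coord; ring. Qed.

(** Three linear conditions on a 4-dimensional tangent space leave a nonzero vector. *)
Lemma pick_element (K : mat -> Prop) (X1 X2 X3 X4 : mat) (f g h : mat -> R) :
  subgroup K -> lie K X1 -> lie K X2 -> lie K X3 -> lie K X4 ->
  (forall c1 c2 c3 c4,
    (forall k, (k < 6)%nat -> c1 * coord k X1 + c2 * coord k X2 + c3 * coord k X3 + c4 * coord k X4 = 0) ->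
    c1 = 0 /\ c2 = 0 /\ c3 = 0 /\ c4 = 0) ->
  linear_form f -> linear_form g -> linear_form h ->
  exists X, lie K X /\ f X = 0 /\ g X = 0 /\ h X = 0 /\
    ~ (coord 0 X = 0 /\ coord 1 X = 0 /\ coord 2 X = 0 /\ coord 3 X = 0 /\
       coord 4 X = 0 /\ coord 5 X = 0).
Proof.
  intros HS L1 L2 L3 L4 Hind Hf Hg Hh.
  destruct (hom_4_3 (f X1) (f X2) (f X3) (f X4) (g X1) (g X2) (g X3) (g X4)
    (h X1) (h X2) (h X3) (h X4)) as (c1 & c2 & c3 & c4 & Hn & Ef & Eg & Eh).
  exists (fun i j => c1 * X1 i j + c2 * X2 i j + c3 * X3 i j + c4 * X4 i j).
  split; [|rewrite Hf, Hg, Hh; split; [lra|split; [lra|split; [lra|]]]].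
  - pose proof (lie_scale _ _ c1 L1) as M1; pose proof (lie_scale _ _ c2 L2) as M2.
    pose proof (lie_scale _ _ c3 L3) as M3; pose proof (lie_scale _ _ c4 L4) as M4.
    exact (lie_add _ _ _ HS (lie_add _ _ _ HS (lie_add _ _ _ HS M1 M2) M3) M4).
  - rewrite !linear_coord; intros (E0 & E1 & E2 & E3 & E4 & E5).
    destruct (Hind c1 c2 c3 c4) as (Z1 & Z2 & Z3 & Z4); [|tauto].
    intros k Hk; do 6 (destruct k as [|k]; [assumption|]); lia.
Qed.

(* Up to the factor |U|^2, om0 U, om1 U, om2 U, om3 U are coordinates on the horizontal space. *)
Lemma om_coord (U X : mat) :
  let n := om0 U U in
  n * coord 0 X = coord 0 U * om0 U X - coord 1 U * om1 U X - coord 2 U * om2 U X - coord 3 U * om3 U X /\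
  n * coord 1 X = coord 1 U * om0 U X + coord 0 U * om1 U X - coord 3 U * om2 U X + coord 2 U * om3 U X /\
  n * coord 2 X = coord 2 U * om0 U X + coord 3 U * om1 U X + coord 0 U * om2 U X - coord 1 U * om3 U X /\
  n * coord 3 X = coord 3 U * om0 U X - coord 2 U * om1 U X + coord 1 U * om2 U X + coord 0 U * om3 U X.
Proof. unfold om0, om1, om2, om3; cbv zeta; repeat split; ring. Qed.

(** In the orthogonal horizontal frame U, J_1 U, J_2 U, J_3 U, where [om1], [om2], [om3] are inner
    products with the J_i U, a determinant with first row U reduces to a 3x3 one. *)
Lemma det4_om (U X Y Z : mat) :
  om0 U U * det4 U X Y Z =
    om1 U X * (om2 U Y * om3 U Z - om3 U Y * om2 U Z)
  - om2 U X * (om1 U Y * om3 U Z - om3 U Y * om1 U Z)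
  + om3 U X * (om1 U Y * om2 U Z - om2 U Y * om1 U Z).
Proof. unfold det4, om0, om1, om2, om3; cbv zeta; ring. Qed.

Lemma om_eq0 (U X : mat) :
  om0 U U <> 0 -> om0 U X = 0 -> om1 U X = 0 -> om2 U X = 0 -> om3 U X = 0 ->
  coord 0 X = 0 /\ coord 1 X = 0 /\ coord 2 X = 0 /\ coord 3 X = 0.
Proof.
  intros Hn E0 E1 E2 E3.
  destruct (om_coord U X) as (C0 & C1 & C2 & C3).
  rewrite E0, E1, E2, E3 in C0, C1, C2, C3.
  repeat split; apply (Rmult_eq_reg_l (om0 U U)); trivial; lra.
Qed.

(** The equations are the real and imaginary parts of (a + ib)(p + iq) = 0. *)
Lemma two_squares_cancel (a b p q : R) :
  a * p - b * q = 0 -> b * p + a * q = 0 -> (p <> 0 \/ q <> 0) -> a = 0 /\ b = 0.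
Proof.
  intros E1 E2 Hpq.
  assert (Hn : 0 < p * p + q * q)
    by (destruct Hpq as [H|H]; apply Rsqr_pos_lt in H; unfold Rsqr in H; nra).
  split; apply (Rmult_eq_reg_r (p * p + q * q)); try lra.
  - transitivity (p * (a * p - b * q) + q * (b * p + a * q)); [ring|rewrite E1, E2; ring].
  - transitivity (p * (b * p + a * q) - q * (a * p - b * q)); [ring|rewrite E1, E2; ring].
Qed.

(** Definiteness of d Im Omega on complex planes: multiplying the first relation by 2b and
    eliminating [w1], [w2], [m] gives t b' (2 |v|^2 + n b^2) = 0, whose last factor is positive. *)
Lemma definite_relations_absurd (n t b b' m v1 v2 w1 w2 : R) :
  0 < n -> t <> 0 -> b <> 0 -> b' <> 0 ->
  n * m = t * (v1 * w2 - v2 * w1) -> 2 * m = - (t * b * b') ->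
  b * w1 = - (b' * v2) -> b * w2 = b' * v1 -> False.
Proof.
  intros Hn Ht Hb Hb' D E1 E2 E3.
  assert (E4 : t * b' * (2 * (v1 * v1 + v2 * v2) + n * (b * b)) = 0).
  { transitivity (b * (2 * (t * (v1 * w2 - v2 * w1)) + n * (t * b * b'))
       - 2 * t * v1 * (b * w2 - b' * v1) + 2 * t * v2 * (b * w1 + b' * v2)); [ring|].
    rewrite E2, E3, <- D.
    transitivity (b * n * (2 * m + t * b * b')); [ring | rewrite E1; ring]. }
  assert (Hpos : 0 < n * (b * b)).
  { apply Rmult_lt_0_compat; [exact Hn | apply Rsqr_pos_lt; exact Hb]. }
  pose proof (Rle_0_sqr v1); pose proof (Rle_0_sqr v2); unfold Rsqr in *.
  apply Rmult_integral in E4 as [E4|E4]; [apply Rmult_integral in E4; tauto | lra].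
Qed.

(** An adapted quadruple is built in [lie K]: [U] and [N] horizontal, [V] and [W] horizontally
    orthogonal to them. Evaluating d Im Omega on it gives the contradiction. *)
Lemma no_coassociative_std (lam r : R) (K : mat -> Prop) :
  r <> 0 -> subgroup K -> (forall g, K g -> mm (tr g) g = id5) ->
  tdim4 K (std_pt r) ->
  (forall X Y Z, lie K X -> lie K Y -> lie K Z ->
     phi lam (std_pt r) (fvec X (std_pt r)) (fvec Y (std_pt r)) (fvec Z (std_pt r)) = 0) ->
  False.
Proof.
  intros Hr HS HK Hdim Hphi.
  assert (Hsk : forall X, lie K X -> forall i j, X i j = - X j i)
    by (intros X HX; exact (lie_skew K X HK HX)).
  assert (HRe : forall X Y Z, lie K X -> lie K Y -> lie K Z -> ReOm X Y Z = 0)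
    by (intros X Y Z HX HY HZ; apply (std_phi lam r); auto).
  destruct (std_dim4 r K Hr HK Hdim) as (X1 & X2 & X3 & X4 & L1 & L2 & L3 & L4 & Hind & Hspan).
  pose proof (ImOm_vanishes (lie K) X1 X2 X3 X4 L1 L2 L3 L4 Hind Hspan HRe) as HIm.
  pose proof (fun f g h => pick_element K X1 X2 X3 X4 f g h HS L1 L2 L3 L4 Hind) as pick.
  clear Hspan Hind Hdim Hphi.
  (* If all vertical parts vanished, the tangent space would be the whole horizontal space. For [X]
     and [Y] along its first two axes, [coord 4] of the bracket is minus the nonzero product
     [coord 0 X * coord 1 Y]: the horizontal distribution is not integrable. *)
  assert (Hvert : ~ forall X, lie K X -> coord 4 X = 0 /\ coord 5 X = 0).
  { intro Hb.
    destruct (pick (coord 1) (coord 2) (coord 3)) as (X & HX & X1' & X2' & X3' & HX0);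
      try apply linear_coord.
    destruct (pick (coord 0) (coord 2) (coord 3)) as (Y & HY & Y0 & Y2 & Y3 & HY0);
      try apply linear_coord.
    destruct (Hb X HX) as (X4' & X5'); destruct (Hb Y HY) as (Y4 & Y5).
    assert (E : coord 4 (bracket X Y) = 0).
    { apply (coord_functional_bracket K (coord 4) 0 0 0 0 1 0); auto.
      - intro M; ring.
      - intros Z HZ; apply Hb; exact HZ. }
    assert (E' : coord 4 (bracket X Y) = - om1 X Y + coord 5 X * (Y f0 f3 - Y f1 f2)
      - (X f0 f3 - X f1 f2) * coord 5 Y).
    { rewrite (skewmatE X (Hsk X HX)), (skewmatE Y (Hsk Y HY)).
      unfold om1, coord, bracket, mm, sum5, skewmat; simpl; ring. }
    rewrite E, X5', Y5 in E'; unfold om1 in E'; rewrite X1', X2', X3', Y2, Y3 in E'.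
    assert (E'' : coord 0 X * coord 1 Y = 0) by lra.
    apply Rmult_integral in E''; tauto. }
  (* A nonzero horizontal [U]; the repeated condition fills the third slot. *)
  destruct (pick (coord 4) (coord 5) (coord 5)) as (U & HU & U4 & U5 & _ & HU0);
    try apply linear_coord.
  assert (Hn : 0 < om0 U U).
  { unfold om0; pose proof (Rle_0_sqr (coord 0 U)); pose proof (Rle_0_sqr (coord 1 U));
    pose proof (Rle_0_sqr (coord 2 U)); pose proof (Rle_0_sqr (coord 3 U)); unfold Rsqr in *.
    apply Rnot_le_lt; intro Hle; apply HU0; repeat split; trivial; apply Rsqr_0_uniq;
      unfold Rsqr; lra. }
  assert (Hn' : om0 U U <> 0) by (apply Rgt_not_eq; exact Hn).
  (* [RU] and [IU] are the real and imaginary parts of Omega(U, Y, Z) = 0. *)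
  assert (RU : forall Y Z, lie K Y -> lie K Z ->
    coord 5 Z * om1 U Y - coord 4 Z * om2 U Y - (coord 5 Y * om1 U Z - coord 4 Y * om2 U Z) = 0).
  { intros Y Z HY HZ; rewrite <- (HRe U Y Z HU HY HZ); unfold ReOm; rewrite U4, U5.
    unfold om1, om2; ring. }
  assert (IU : forall Y Z, lie K Y -> lie K Z ->
    coord 4 Z * om1 U Y + coord 5 Z * om2 U Y - (coord 4 Y * om1 U Z + coord 5 Y * om2 U Z) = 0).
  { intros Y Z HY HZ; rewrite <- (HIm U Y Z HU HY HZ); unfold ImOm; rewrite U4, U5.
    unfold om1, om2; ring. }
  (* For horizontal [Y], the product of (coord 5 + i coord 4)(Z) and (om1 + i om2)(U, Y) is 0 for
     every [Z]; by [Hvert] the first factor is nonzero for some [Z]. *)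
  assert (Hhor : forall Y, lie K Y -> coord 4 Y = 0 -> coord 5 Y = 0 ->
    om1 U Y = 0 /\ om2 U Y = 0).
  { intros Y HY Y4 Y5; apply NNPP; intro Hne; apply Hvert; intros Z HZ.
    pose proof (RU Y Z HY HZ) as R1; pose proof (IU Y Z HY HZ) as I1.
    rewrite Y4, Y5 in R1, I1.
    destruct (two_squares_cancel (coord 5 Z) (coord 4 Z) (om1 U Y) (om2 U Y)); [lra|lra| |tauto].
    tauto. }
  (* [N] is horizontal and orthogonal to [U]; by [Hhor] it is a multiple of J_3 U. *)
  destruct (pick (om0 U) (coord 4) (coord 5)) as (N & HN & N0 & N4 & N5 & HN0);
    try apply linear_coord; try apply linear_om0.
  destruct (Hhor N HN N4 N5) as (N1 & N2).
  assert (N3 : om3 U N <> 0).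
  { intro N3; apply HN0; destruct (om_eq0 U N Hn' N0 N1 N2 N3) as (? & ? & ? & ?).
    repeat split; assumption. }
  (* [V] and [W] are horizontally orthogonal to [U] and [N], with vertical parts on different axes.
     Were such a vertical part zero, [Hhor] would make all coordinates of the element vanish. *)
  destruct (pick (om0 U) (om3 U) (coord 4)) as (V & HV & V0 & V3 & V4 & HV0);
    try apply linear_coord; try apply linear_om0; try apply linear_om3.
  destruct (pick (om0 U) (om3 U) (coord 5)) as (W & HW & W0 & W3 & W5 & HW0);
    try apply linear_coord; try apply linear_om0; try apply linear_om3.
  assert (V5 : coord 5 V <> 0).
  { intro V5; apply HV0; destruct (Hhor V HV V4 V5) as (V1 & V2).
    destruct (om_eq0 U V Hn' V0 V1 V2 V3) as (? & ? & ? & ?); repeat split; assumption. }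
  assert (W4 : coord 4 W <> 0).
  { intro W4; apply HW0; destruct (Hhor W HW W4 W5) as (W1 & W2).
    destruct (om_eq0 U W Hn' W0 W1 W2 W3) as (? & ? & ? & ?); repeat split; assumption. }
  (* Omega(U, V, W) = 0 expresses the horizontal part of [W] through that of [V]. *)
  pose proof (RU V W HV HW) as R1; pose proof (IU V W HV HW) as I1.
  rewrite V4, W5 in R1, I1.
  (* The left side vanishes by [ImOm_bracket], which ties [det4 U N V W] to the one surviving
     product [om3 U N * vol2 V W]. *)
  pose proof (d_ImOm U N V W (Hsk U HU) (Hsk N HN) (Hsk V HV) (Hsk W HW)) as E.
  rewrite !(ImOm_bracket K) in E by assumption.
  unfold vol2 in E; rewrite U4, U5, N4, N5, V4, W5 in E.
  pose proof (det4_om U N V W) as D; rewrite N1, N2, V3, W3 in D.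
  apply (definite_relations_absurd (om0 U U) (om3 U N) (coord 5 V) (coord 4 W)
    (det4 U N V W) (om1 U V) (om2 U V) (om1 U W) (om2 U W)); trivial.
  - clear - D; lra.
  - clear - E; lra.
  - clear - R1; lra.
  - clear - I1; lra.
Qed.

(** For nonzero [A], an adapted frame moves the point to a standard one and [K] to a conjugate
    group, where no such tangent space exists. *)
Lemma coassociative_orbit_zero_section (lam : R) (K : mat -> Prop) (x : vec) (A : mat) :
  subgroup K -> (forall g, K g -> mm (tr g) g = id5) -> inE (x, A) -> tdim4 K (x, A) ->
  (forall X Y Z, lie K X -> lie K Y -> lie K Z ->
     phi lam (x, A) (fvec X (x, A)) (fvec Y (x, A)) (fvec Z (x, A)) = 0) ->
  A = zmat.
Proof.
  intros HS HK HE Hdim Hphi; apply NNPP; intro HA.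
  destruct (adapted_frame x A HE HA) as (G & r & Hr & H' & Hstd).
  pose proof (orthogonal_comm G H') as H.
  apply (no_coassociative_std lam r (conj_group G K) Hr).
  - apply subgroup_conj_group; assumption.
  - apply orthogonal_conj_group; assumption.
  - rewrite <- Hstd; apply tdim4_act; assumption.
  - rewrite <- Hstd; apply phi_conj_group; assumption.
Qed.

(** * Transitivity on the zero section *)

Lemma choose_seq {T : Type} (P : nat -> T -> Prop) :
  (forall n, exists x, P n x) -> exists f : nat -> T, forall n, P n (f n).
Proof.
  intro H; exists (fun n => proj1_sig (constructive_indefinite_description _ (H n))).
  intro n; exact (proj2_sig (constructive_indefinite_description _ (H n))).
Qed.

Lemma inv_S_lt (e : R) : 0 < e -> exists N, forall n, (N <= n)%nat -> / (INR n + 1) < e.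
Proof.
  intro He; destruct (archimed_cor1 e He) as (N & HN & HN0).
  exists N; intros n Hn; apply Rle_lt_trans with (/ INR N); [|exact HN].
  apply Rinv_le_contravar; [apply lt_0_INR; exact HN0|].
  apply le_INR in Hn; lra.
Qed.

Lemma Un_cv_subseq (u : nat -> R) (s : nat -> nat) (l : R) :
  (forall n, (n <= s n)%nat) -> Un_cv u l -> Un_cv (fun n => u (s n)) l.
Proof.
  intros Hs H e He; destruct (H e He) as (N & HN).
  exists N; intros n Hn; apply HN; specialize (Hs n); lia.
Qed.

(** Bolzano-Weierstrass gives a cluster point, approached within 1/(n + 1) at some index at least n.
    The extraction [s] dominates the identity, which suffices for passing to limits. *)
Lemma bounded_subseq_cv (u : nat -> R) (a b : R) :
  (forall n, a <= u n <= b) ->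
  exists (s : nat -> nat) (l : R), (forall n, (n <= s n)%nat) /\ Un_cv (fun n => u (s n)) l.
Proof.
  intro Hu.
  destruct (Bolzano_Weierstrass u (fun c => a <= c <= b) (compact_P3 a b) Hu) as (l & Hl).
  destruct (choose_seq (fun n p => (n <= p)%nat /\ Rabs (u p - l) < / (INR n + 1))) as (s & Hs).
  { intro n.
    assert (Hpos : 0 < / (INR n + 1)) by (apply Rinv_0_lt_compat; pose proof (pos_INR n); lra).
    destruct (Hl (disc l (mkposreal _ Hpos)) n) as (p & Hp & Hd).
    - exists (mkposreal _ Hpos); intros y Hy; exact Hy.
    - exists p; split; [exact Hp | exact Hd]. }
  exists s, l; split; [intro n; apply Hs|].
  intros e He; destruct (inv_S_lt e He) as (N & HN).
  exists N; intros n Hn; unfold Rdist.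
  apply Rlt_trans with (/ (INR n + 1)); [apply Hs | apply HN; exact Hn].
Qed.

(** Successive extraction, limits already obtained surviving the next one; used for the 25 entries
    of a matrix sequence. *)
Lemma bounded_subseq_cv_list (us : list (nat -> R)) (a b : R) :
  (forall u, In u us -> forall n, a <= u n <= b) ->
  exists s : nat -> nat, (forall n, (n <= s n)%nat) /\
    forall u, In u us -> exists l, Un_cv (fun n => u (s n)) l.
Proof.
  induction us as [|u us IH]; intro H.
  - exists (fun n => n); split; [auto | intros u []].
  - destruct IH as (s & Hs & Hus); [intros; apply H; right; assumption|].
    destruct (bounded_subseq_cv (fun n => u (s n)) a b) as (s' & l & Hs' & Hl);
      [intro n; apply H; left; reflexivity|].
    exists (fun n => s (s' n)); split.
    + intro n; specialize (Hs (s' n)); specialize (Hs' n); lia.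
    + intros v [<-|Hv]; [exists l; exact Hl|].
      destruct (Hus v Hv) as (lv & Hlv); exists lv.
      exact (Un_cv_subseq (fun n => v (s n)) s' lv Hs' Hlv).
Qed.

Lemma Un_cv_const (c : R) : Un_cv (fun _ => c) c.
Proof. intros e He; exists 0%nat; intros; unfold Rdist; rewrite Rminus_diag, Rabs_R0; exact He. Qed.

Lemma Un_cv_sum5 (f : I5 -> nat -> R) (l : I5 -> R) :
  (forall i, Un_cv (f i) (l i)) -> Un_cv (fun n => sum5 (fun i => f i n)) (sum5 l).
Proof. intro H; unfold sum5; repeat apply CV_plus; apply H. Qed.

Lemma orthogonal_entry_bound (g : mat) (i j : I5) :
  mm (tr g) g = id5 -> -1 <= g i j <= 1.
Proof.
  intro H; pose proof (f_equal (fun M : mat => M j j) H) as E; cbv beta in E.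
  assert (Hd : id5 j j = 1) by (clear; cases5 j; reflexivity).
  rewrite Hd in E; unfold mm, tr, sum5 in E.
  assert (Hi : g i j * g i j <= 1).
  { pose proof (Rle_0_sqr (g f0 j)); pose proof (Rle_0_sqr (g f1 j));
    pose proof (Rle_0_sqr (g f2 j)); pose proof (Rle_0_sqr (g f3 j));
    pose proof (Rle_0_sqr (g f4 j)); unfold Rsqr in *; clear H Hd; cases5 i; lra. }
  split; nra.
Qed.

(** Compactness of [K]: entries of orthogonal matrices lie in [-1, 1], so a maximising sequence has
    an entrywise subsequential limit, which closedness keeps in [K]. *)
Lemma orbit_maximum (K : mat -> Prop) (x z : vec) :
  K id5 -> (forall g, K g -> mm (tr g) g = id5) -> closed_m K ->
  exists g, K g /\ forall h, K h -> dot (mv h x) z <= dot (mv g x) z.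
Proof.
  intros H1 HK Hcl.
  assert (Hb : exists B, forall g, K g -> dot (mv g x) z <= B).
  { exists (sum5 (fun i => sum5 (fun j => Rabs (x j * z i)))); intros g Hg.
    assert (Hle : forall f h : I5 -> R, (forall i, f i <= h i) -> sum5 f <= sum5 h).
    { intros f h Hfh; unfold sum5; pose proof (Hfh f0); pose proof (Hfh f1);
      pose proof (Hfh f2); pose proof (Hfh f3); pose proof (Hfh f4); lra. }
    replace (dot (mv g x) z) with (sum5 (fun i => sum5 (fun j => g i j * (x j * z i))))
      by (unfold dot, mv, sum5; ring).
    apply Hle; intro i; apply Hle; intro j.
    pose proof (orthogonal_entry_bound g i j (HK g Hg)) as Hij.
    unfold Rabs; destruct (Rcase_abs (x j * z i)); nra. }
  destruct Hb as (B & HB).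
  destruct (completeness (fun s => exists g, K g /\ s = dot (mv g x) z)) as (S & Hub & Hlub).
  { exists B; intros s (g & Hg & ->); auto. }
  { exists (dot (mv id5 x) z), id5; auto. }
  destruct (choose_seq (fun n g => K g /\ S - / (INR n + 1) < dot (mv g x) z)) as (gs & Hgs).
  { intro n; apply NNPP; intro Hno.
    assert (Hpos : 0 < / (INR n + 1)) by (apply Rinv_0_lt_compat; pose proof (pos_INR n); lra).
    assert (S <= S - / (INR n + 1)); [|lra].
    apply Hlub; intros s (g & Hg & ->); apply Rnot_lt_le; intro Hlt; apply Hno; exists g; auto. }
  set (idxs := [f0; f1; f2; f3; f4]).
  destruct (bounded_subseq_cv_list
    (flat_map (fun i => map (fun j n => gs n i j) idxs) idxs) (-1) 1) as (s & Hs & Hcv).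
  { intros u Hu; apply in_flat_map in Hu as (i & _ & Hu).
    apply in_map_iff in Hu as (j & <- & _); intro n.
    apply orthogonal_entry_bound, HK, Hgs. }
  assert (Hin : forall i, In i idxs) by (intro i; cases5 i; simpl; tauto).
  assert (Hcv' : forall i j, exists l, Un_cv (fun n => gs (s n) i j) l).
  { intros i j; apply (Hcv (fun n => gs n i j)).
    apply in_flat_map; exists i; split; [apply Hin|].
    apply (in_map (fun j n => gs n i j)), Hin. }
  set (g := fun i j => proj1_sig (constructive_indefinite_description _ (Hcv' i j))).
  assert (Hg : forall i j, Un_cv (fun n => gs (s n) i j) (g i j))
    by (intros i j; exact (proj2_sig (constructive_indefinite_description _ (Hcv' i j)))).
  clearbody g; exists g; split.
  - apply Hcl; intros e He.
    assert (Hd : Un_cv (fun n => mdist2 g (gs (s n))) 0).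
    { replace 0 with (mdist2 g g) by (unfold mdist2, sum5; ring).
      unfold mdist2.
      apply (Un_cv_sum5 (fun i n => sum5 (fun j => (g i j - gs (s n) i j) ^ 2))); intro i.
      apply (Un_cv_sum5 (fun j n => (g i j - gs (s n) i j) ^ 2)); intro j.
      simpl; repeat apply CV_mult;
        try (apply CV_minus; [apply Un_cv_const | apply Hg]); apply Un_cv_const. }
    destruct (Hd e He) as (N & HN).
    exists (gs (s N)); split; [apply Hgs|].
    specialize (HN N (Nat.le_refl N)); unfold Rdist in HN; rewrite Rminus_0_r in HN.
    apply Rle_lt_trans with (2 := HN), Rle_abs.
  - intros h Hh; apply Rle_trans with S; [apply Hub; exists h; auto|].
    assert (Hd : Un_cv (fun n => dot (mv (gs (s n)) x) z) (dot (mv g x) z)).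
    { unfold dot, mv.
      apply (Un_cv_sum5 (fun i n => sum5 (fun j => gs (s n) i j * x j) * z i)); intro i.
      apply CV_mult; [|apply Un_cv_const].
      apply (Un_cv_sum5 (fun j n => gs (s n) i j * x j)); intro j.
      apply CV_mult; [apply Hg | apply Un_cv_const]. }
    (* Were the value at the limit below the supremum, half the gap would exceed both the
       convergence error and the deficit of the approximants, which is absurd. *)
    apply Rnot_lt_le; intro Hlt.
    set (e := (S - dot (mv g x) z) / 2).
    assert (He : 0 < e) by (unfold e; lra).
    destruct (Hd e He) as (N & HN); destruct (inv_S_lt e He) as (N' & HN').
    set (n := Nat.max N N').
    specialize (HN n ltac:(lia)); apply Rabs_def2 in HN.
    specialize (HN' (s n)); specialize (Hs n); destruct (Hgs (s n)) as (_ & Hn).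
    assert (N' <= s n)%nat by lia.
    specialize (HN' H); unfold e in *; lra.
Qed.

(** * Dimension count and critical points on the sphere *)

Lemma sum5_two_three (i j : I5) : i <> j ->
  exists k l m, forall f : I5 -> R, sum5 f = f i + f j + (f k + f l + f m).
Proof.
  revert i j.
  assert (H : forall i j, i = j \/
    exists k l m, forall f : I5 -> R, sum5 f = f i + f j + (f k + f l + f m)).
  { intros i j; cases5 i; cases5 j; try (left; reflexivity); right;
    first
     [ exists f2, f3, f4; intro; unfold sum5; ring | exists f1, f3, f4; intro; unfold sum5; ring
     | exists f1, f2, f4; intro; unfold sum5; ring | exists f1, f2, f3; intro; unfold sum5; ring
     | exists f0, f3, f4; intro; unfold sum5; ring | exists f0, f2, f4; intro; unfold sum5; ring
     | exists f0, f2, f3; intro; unfold sum5; ring | exists f0, f1, f4; intro; unfold sum5; ring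
     | exists f0, f1, f3; intro; unfold sum5; ring | exists f0, f1, f2; intro; unfold sum5; ring ]. }
  intros i j Hij; destruct (H i j); [contradiction | assumption].
Qed.

(** The four vectors lie in the 3-dimensional complement of [y] and [w]. A combination is made to
    vanish in three coordinates; the two relations kill the other two. *)
Lemma four_vectors_dependent (y w v1 v2 v3 v4 : vec) :
  dot y y = 1 -> dot w y = 0 -> w <> (fun _ => 0) ->
  (forall v, In v [v1; v2; v3; v4] -> dot v y = 0 /\ dot v w = 0) ->
  exists c1 c2 c3 c4, (c1 <> 0 \/ c2 <> 0 \/ c3 <> 0 \/ c4 <> 0) /\
    forall i, c1 * v1 i + c2 * v2 i + c3 * v3 i + c4 * v4 i = 0.
Proof.
  intros Hy Hwy Hw Hv.
  (* [y] and [w] are independent, so some 2x2 minor is nonzero; otherwise w = <w, y> y = 0. *)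
  assert (Hm : exists i j, y i * w j - y j * w i <> 0).
  { apply NNPP; intro Hno; apply Hw, vec_ext; intro j.
    assert (Hm : forall i, y i * w j = y j * w i).
    { intro i; apply NNPP; intro Hne; apply Hno; exists i, j; lra. }
    transitivity (dot y y * w j); [rewrite Hy; ring|].
    transitivity (sum5 (fun i => y i * (y i * w j))); [unfold dot, sum5; ring|].
    transitivity (y j * dot w y); [unfold sum5; rewrite !Hm; unfold dot, sum5; ring | rewrite Hwy; ring]. }
  destruct Hm as (i & j & Hm).
  assert (Hij : i <> j) by (intros ->; apply Hm; ring).
  destruct (sum5_two_three i j Hij) as (k & l & m & Hsum).
  destruct (hom_4_3 (v1 k) (v2 k) (v3 k) (v4 k) (v1 l) (v2 l) (v3 l) (v4 l)
    (v1 m) (v2 m) (v3 m) (v4 m)) as (c1 & c2 & c3 & c4 & Hn & Ek & El & Em).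
  exists c1, c2, c3, c4; split; [exact Hn|].
  set (u := fun a => c1 * v1 a + c2 * v2 a + c3 * v3 a + c4 * v4 a).
  assert (Uk : u k = 0) by (unfold u; lra).
  assert (Ul : u l = 0) by (unfold u; lra).
  assert (Um : u m = 0) by (unfold u; lra).
  assert (Hu : forall t, (forall v, In v [v1; v2; v3; v4] -> dot v t = 0) -> dot u t = 0).
  { intros t Ht.
    transitivity (c1 * dot v1 t + c2 * dot v2 t + c3 * dot v3 t + c4 * dot v4 t);
      [unfold u, dot, sum5; ring | rewrite !Ht by (simpl; tauto); ring]. }
  pose proof (Hu y (fun v H => proj1 (Hv v H))) as Ey.
  pose proof (Hu w (fun v H => proj2 (Hv v H))) as Ew.
  unfold dot in Ey, Ew; rewrite Hsum, Uk, Ul, Um in Ey, Ew.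
  (* Cramer's rule for the 2x2 system left by orthogonality to [y] and [w]. *)
  assert (Ui : u i = 0).
  { apply (Rmult_eq_reg_r (y i * w j - y j * w i)); [|exact Hm].
    transitivity (w j * (u i * y i + u j * y j) - y j * (u i * w i + u j * w j)); [ring|].
    transitivity (w j * 0 - y j * 0); [f_equal; f_equal; lra | ring]. }
  assert (Uj : u j = 0).
  { apply (Rmult_eq_reg_r (y i * w j - y j * w i)); [|exact Hm].
    transitivity (y i * (u i * w i + u j * w j) - w i * (u i * y i + u j * y j)); [ring|].
    transitivity (y i * 0 - w i * 0); [f_equal; f_equal; lra | ring]. }
  assert (Huu : dot u u = 0) by (unfold dot; rewrite Hsum, Ui, Uj, Uk, Ul, Um; ring).
  exact (dot_eq0 u Huu).
Qed.

Lemma derivable_pt_lim_mv (c : R -> mat) (X : mat) (y : vec) (i : I5) :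
  mderiv c 0 X -> derivable_pt_lim (fun t => mv (c t) y i) 0 (mv X y i).
Proof.
  intro H; apply (derivable_pt_lim_sum5 (fun j t => c t i j * y j)); intro j.
  replace (X i j * y j) with (y j * X i j) by ring.
  replace (fun t => c t i j * y j) with (fun t => y j * c t i j)
    by (apply functional_extensionality; intro; ring).
  apply (derivable_pt_lim_scal (fun t => c t i j)), H.
Qed.

Lemma critical_point (K : mat -> Prop) (y z : vec) (X : mat) :
  (forall h, K h -> dot (mv h y) z <= dot y z) -> lie K X -> dot (mv X y) z = 0.
Proof.
  intros Hmax (c & Hc & Hc0 & HX).
  assert (HD : derivable_pt_lim (fun t => dot (mv (c t) y) z) 0 (dot (mv X y) z)).
  { apply (derivable_pt_lim_sum5 (fun i t => mv (c t) y i * z i)); intro i.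
    replace (mv X y i * z i) with (z i * mv X y i) by ring.
    replace (fun t => mv (c t) y i * z i) with (fun t => z i * mv (c t) y i)
      by (apply functional_extensionality; intro; ring).
    apply (derivable_pt_lim_scal (fun t => mv (c t) y i)).
    exact (derivable_pt_lim_mv c X y i HX). }
  (* The interval around 0 is arbitrary; the derivative packaged with [HD] computes to
     [dot (mv X y) z]. *)
  pose proof (deriv_maximum (fun t => dot (mv (c t) y) z) (-1) 1 0 (exist _ _ HD)) as E.
  apply E; try lra.
  intros t _ _; rewrite Hc0, mv_id; apply Hmax, Hc.
Qed.

Lemma fvec_zero (X : mat) (y : vec) : fvec X (y, zmat) = (mv X y, zmat).
Proof.
  unfold fvec; simpl; rewrite mm_zmat_r, mm_zmat_l; f_equal.
  apply mat_ext; intros i j; unfold zmat; ring.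
Qed.

Lemma orbit_transitive (K : mat -> Prop) (x z : vec) :
  subgroup K -> (forall g, K g -> mm (tr g) g = id5) -> closed_m K ->
  dot x x = 1 -> dot z z = 1 ->
  (forall g, K g -> tdim4 K (mv g x, zmat)) ->
  exists g, K g /\ mv g x = z.
Proof.
  intros HS HK Hcl Hx Hz Hdim.
  destruct (orbit_maximum K x z (proj1 HS) HK Hcl) as (g & Hg & Hmax).
  exists g; split; [exact Hg|].
  set (y := mv g x) in *.
  assert (Hy : dot y y = 1) by (unfold y; rewrite dot_mv; auto).
  assert (Hmax' : forall h, K h -> dot (mv h y) z <= dot y z).
  { intros h Hh; unfold y; rewrite <- mv_mm; apply Hmax, HS; assumption. }
  destruct (Hdim g Hg) as (X1 & X2 & X3 & X4 & L1 & L2 & L3 & L4 & Hind & _).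
  fold y in Hind; rewrite !fvec_zero in Hind.
  (* The component of [z] orthogonal to the maximiser [y]. The critical point condition makes it
     orthogonal to all tangent vectors of the orbit at [y], so it vanishes by dimension. *)
  set (w := fun i => z i - dot y z * y i).
  assert (Hw : w = fun _ => 0).
  { apply NNPP; intro Hw.
    destruct (four_vectors_dependent y w (mv X1 y) (mv X2 y) (mv X3 y) (mv X4 y))
      as (c1 & c2 & c3 & c4 & Hn & Hc); trivial.
    - transitivity (dot y z - dot y z * dot y y); [|rewrite Hy; ring].
      unfold w, dot, sum5; ring.
    - assert (HX : forall X, lie K X -> dot (mv X y) y = 0 /\ dot (mv X y) w = 0).
      { intros X HX.
        assert (Hs : dot (mv X y) y = 0).
        { pose proof (dot_skew X y y (lie_skew K X HK HX)); rewrite dot_sym; lra. }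
        split; [exact Hs|].
        transitivity (dot (mv X y) z - dot y z * dot (mv X y) y);
          [unfold w, dot, sum5; ring|].
        rewrite Hs, (critical_point K y z X Hmax' HX); ring. }
      intros v [<-|[<-|[<-|[<-|[]]]]]; apply HX; assumption.
    - destruct (Hind c1 c2 c3 c4) as (? & ? & ? & ?); [|tauto].
      unfold tadd, tscale, tzero; simpl; f_equal.
      + apply vec_ext; intro i; rewrite <- (Hc i); ring.
      + apply mat_ext; intros i j; unfold zmat; ring. }
  assert (Hzy : forall i, z i = dot y z * y i).
  { intro i; pose proof (f_equal (fun v : vec => v i) Hw) as E; unfold w in E; lra. }
  (* [z] is a multiple of [y] and both are unit vectors, so the factor is 1 or -1. *)
  assert (Hd2 : dot y z * dot y z = 1).
  { rewrite <- Hz; transitivity (dot y z * dot y z * dot y y); [rewrite Hy; ring|].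
    unfold dot at 4; unfold sum5; rewrite !Hzy; unfold dot at 3; unfold sum5; ring. }
  destruct (Req_dec (dot y z) 1) as [E|E].
  { apply vec_ext; intro i; rewrite Hzy, E; ring. }
  assert (Em : dot y z = -1) by nra.
  exfalso.
  (* The maximum -1 is also the least possible value on unit vectors, so each [mv h y] equals -z,
     which is [y]. *)
  assert (Hfix : forall h, K h -> mv h y = y).
  { intros h Hh; apply vec_ext; intro i.
    assert (Hhy : dot (mv h y) (mv h y) = 1) by (rewrite dot_mv; auto).
    pose proof (Hmax' h Hh) as Hle; rewrite Em in Hle.
    assert (Hs : dot (fun i => mv h y i + z i) (fun i => mv h y i + z i) = 0).
    { apply Rle_antisym; [|apply dot_ge0].
      transitivity (dot (mv h y) (mv h y) + dot z z + 2 * dot (mv h y) z);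
        [right; unfold dot, sum5; ring | lra]. }
    pose proof (dot_eq0 _ Hs i) as Hi; cbv beta in Hi; rewrite Hzy, Em in Hi; lra. }
  assert (H0 : mv X1 y = fun _ => 0).
  { destruct L1 as (c & Hc & Hc0 & HX); apply vec_ext; intro i.
    apply (uniqueness_limite _ _ _ _ (derivable_pt_lim_mv c X1 y i HX)).
    replace (fun t => mv (c t) y i) with (fun _ : R => y i).
    - apply derivable_pt_lim_const.
    - apply functional_extensionality; intro t; rewrite Hfix by apply Hc; reflexivity. }
  (* A generator that kills [y] contradicts independence. *)
  destruct (Hind 1 0 0 0) as (? & _); [|lra].
  rewrite H0; unfold tadd, tscale, tzero; simpl; f_equal.
  - apply vec_ext; intro i; ring.
  - apply mat_ext; intros i j; unfold zmat; ring.
Qed.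

Theorem theorem1p1 (lam : R) (K : mat -> Prop) (p : pt) :
  0 < lam ->
  (forall g, K g -> SO5 g) ->
  subgroup K -> closed_m K -> connected_m K ->
  inE p ->
  coassoc_orbit lam K p ->
  forall q, orbit K p q <-> zero_section q.
Proof.
  intros _ HSO HS Hcl _ HE Hco q.
  assert (HK : forall g, K g -> mm (tr g) g = id5) by (intros g Hg; apply HSO; exact Hg).
  destruct p as [x A].
  assert (Hp : orbit K (x, A) (x, A)).
  { exists id5; split; [apply HS|]; unfold act; simpl.
    change (mm (mm id5 A) (tr id5)) with (conjm id5 A).
    rewrite mv_id, conj_id_l; reflexivity. }
  destruct (Hco _ Hp) as (Hdim & Hphi).
  pose proof (coassociative_orbit_zero_section lam K x A HS HK HE Hdim Hphi) as HA.
  destruct HE as (Hx & _); subst A.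
  assert (Hact : forall g, act g (x, zmat) = (mv g x, zmat)).
  { intro g; unfold act; simpl; rewrite mm_zmat_r, mm_zmat_l; reflexivity. }
  split.
  - intros (g & Hg & ->); rewrite Hact; split; simpl; [rewrite dot_mv; auto | reflexivity].
  - destruct q as [z B]; intros (Hz & HB); simpl in Hz, HB; subst B.
    destruct (orbit_transitive K x z HS HK Hcl Hx Hz) as (g & Hg & Hgz).
    (* Transitivity takes the 4-dimensional tangent space at every point of the orbit, whereas A = 0
       was obtained at [p] alone. *)
    + intros g Hg; rewrite <- Hact; apply Hco; exists g; auto.
    + exists g; split; [exact Hg | rewrite Hact, Hgz; reflexivity].
Qed.
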